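(* Let $\mathcal T$ be the set of all Pólya trees and $\operatorname{MSET}^{(\ge2)}(\mathcal T)$ the set of finite multisets (rooted forests) of Pólya trees in which each tree that appears, appears at least twice. Then for every $n\ge0$, $$d_n=\sum_{\substack{F\in\operatorname{MSET}^{(\ge2)}(\mathcal T)\\ |F|=n}}\frac{|\{\sigma\in\mathrm{Aut}(F):\sigma_1=0\}|}{|\mathrm{Aut}(F)|}.$$ Furthermore, for every $n\ge1$, $$t_{c,n}(u)=\sum_{T\in\mathcal T,\ |T|=n}t_T(u),\qquad\text{where } t_T(u)=\frac{1}{|\mathrm{Aut}(T)|}\sum_{\sigma\in\mathrm{Aut}(T)}u^{\sigma_1}.$$ In particular, for every $T\in\mathcal T$, $t_T'(1)=|\mathcal P(T)|$, where $\mathcal P(T)$ is the set of (isomorphism classes of) trees obtained from $T$ by pointing (coloring) exactly one vertex.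
   Context: A Pólya tree is a rooted unlabeled tree; its size $|T|$ is its number of vertices; $T(z)=\sum_{n\ge1}t_nz^n$ with $t_n$ the number of Pólya trees of size $n$, satisfying $T(z)=z\exp\bigl(\sum_{i\ge1}T(z^i)/i\bigr)$. Define $d_n=[z^n]D(z)$ where $D(z)=\exp\bigl(\sum_{i\ge2}T(z^i)/i\bigr)$. Define the bivariate series $T_c(z,u)=\sum_{n\ge0}t_{c,n}(u)z^n$ as the unique power series solution of $T_c(z,u)=zu\exp(T_c(z,u))D(z)$; $t_{c,n}(u)$ is a polynomial in $u$. For a rooted tree or rooted forest $X$, $\mathrm{Aut}(X)$ denotes its automorphism group (bijections of the vertex set preserving adjacency and mapping roots to roots), and for $\sigma\in\mathrm{Aut}(X)$, $\sigma_1$ denotes the number of vertices fixed by $\sigma$; the size $|F|$ of a forest is its total number of vertices. *)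

(* Defs.v *)
From HB Require Import structures.
From mathcomp Require Import all_boot all_order all_algebra perm.
From mathcomp Require Import finmap multiset.
From mathcomp Require Import mathcomp_extra boolp classical_sets functions.
From mathcomp Require Import cardinality fsbigop.

Set Implicit Arguments.
Unset Strict Implicit.
Unset Printing Implicit Defensive.

Import GRing.Theory.

(** * Finite graphs with a set of distinguished vertices (the roots) *)

Record rgraph := RGraph {
  vertex :> finType;
  adj : rel vertex;
  isroot : pred vertex }.
Arguments adj {r}.
Arguments isroot {r}.

Definition empty_rgraph : rgraph :=
  @RGraph void (fun _ _ => false) (fun _ => false).

Definition disjoint_union (gs : seq rgraph) : rgraph :=
  @RGraph {i : 'I_(size gs) & nth empty_rgraph gs i}
    (fun x y => (tag x == tag y) && adj (tagged x) (tagged_as x y))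
    (fun x => isroot (tagged x)).

(* [None] is a new vertex, joined to all the roots of [G], and it becomes the
   only root. *)
Definition add_root (G : rgraph) : rgraph :=
  @RGraph (option G)
    (fun x y => match x, y with
                | Some a, Some b => adj a b
                | Some a, None => isroot a
                | None, Some b => isroot b
                | None, None => false
                end)
    (fun x => x == None).

(* An isomorphism of rooted forests; it is stated with equalities, so that the
   inverse bijection has the same property. *)
Definition rgraph_isom (X Y : rgraph) (f : X -> Y) : Prop :=
  [/\ bijective f, forall x y, adj (f x) (f y) = adj x y
    & forall x, isroot (f x) = isroot x].

Definition isomorphic (X Y : rgraph) : Prop :=
  exists f : X -> Y, rgraph_isom f.

Definition rgraph_aut (X : rgraph) : {set {perm X}} :=
  [set s : {perm X} | [forall x, forall y, adj (s x) (s y) == adj x y]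
                      && [forall x, isroot (s x) == isroot x]].

Definition nfix (X : rgraph) (s : {perm X}) : nat := #|[set x | s x == x]|.

(** * Rooted trees and Pólya trees *)

(* A rooted tree is given by its root and the list of the subtrees hanging from
   the root; every finite rooted tree is of this form, for some order of the list,
   and that order is forgotten in [polya] below. *)
Inductive tree := Node of seq tree.

Fixpoint tree_encode (t : tree) : GenTree.tree void :=
  let: Node ts := t in GenTree.Node 0 (map tree_encode ts).

Fixpoint tree_decode (g : GenTree.tree void) : tree :=
  match g with
  | GenTree.Leaf _ => Node [::]
  | GenTree.Node _ gs => Node (map tree_decode gs)
  end.

Lemma tree_encodeK : cancel tree_encode tree_decode.
Proof.
rewrite /cancel; fix IH 1; case=> ts /=; congr Node.
by elim: ts => //= t ts ->; rewrite IH.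
Qed.

HB.instance Definition _ := Countable.copy tree (can_type tree_encodeK).

Fixpoint tree_graph (t : tree) : rgraph :=
  let: Node ts := t in add_root (disjoint_union (map tree_graph ts)).

Definition tree_iso (s t : tree) : bool :=
  `[< isomorphic (tree_graph s) (tree_graph t) >].

Lemma tree_iso_refl : reflexive tree_iso.
Proof. by move=> t; apply/asboolP; exists id; split=> //; exists id. Qed.

Lemma isomorphic_sym X Y : isomorphic X Y -> isomorphic Y X.
Proof.
case=> f [[g fK gK] fadj froot]; exists g; split; first by exists f.
- by move=> x y; rewrite -fadj !gK.
- by move=> x; rewrite -froot gK.
Qed.

Lemma tree_iso_sym : symmetric tree_iso.
Proof.
by move=> s t; apply/asboolP/asboolP; apply: isomorphic_sym.
Qed.

Lemma tree_iso_trans : transitive tree_iso.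
Proof.
move=> t s r /asboolP[f [fb fa fr]] /asboolP[g [gb ga gr]].
apply/asboolP; exists (g \o f); split; first exact: bij_comp.
- by move=> x y; rewrite /= ga fa.
- by move=> x; rewrite /= gr fr.
Qed.

Canonical tree_iso_equiv :=
  EquivRel tree_iso tree_iso_refl tree_iso_sym tree_iso_trans.

(* Pólya trees: isomorphism classes of rooted trees. *)
Definition polya : choiceType := {eq_quot tree_iso}%qT.

Definition polya_graph (T : polya) : rgraph := tree_graph (repr T).

Definition polya_size (T : polya) : nat := #|polya_graph T|.

Local Open Scope mset_scope.

(** * Rooted forests, as finite multisets of Pólya trees *)

Definition forest_graph (F : {mset polya}) : rgraph :=
  disjoint_union [seq polya_graph T | T <- enum_mset F].

Definition forest_size (F : {mset polya}) : nat := #|forest_graph F|.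

(* Membership in MSET^(>= 2); [F T] is the multiplicity of [T] in [F]. *)
Definition mset_ge2 (F : {mset polya}) : Prop :=
  forall T : polya, T \in F -> 1 < F T.

(** * Pointed trees *)

Definition pointed_isomorphic (X : rgraph) (x : X) (Y : rgraph) (y : Y) : Prop :=
  exists2 f : X -> Y, rgraph_isom f & f x = y.

(* The trees obtained by pointing one vertex of [T] are the pairs (T, v); the
   class of (T, v) is represented by the set of the w such that (T, w) is
   isomorphic to (T, v). *)
Definition pointings (T : polya) : {set {set polya_graph T}} :=
  equivalence_partition
    (fun v w : polya_graph T => `[< pointed_isomorphic v w >]) [set: polya_graph T].

Local Open Scope ring_scope.

(** * Formal power series, as sequences of coefficients *)

Section PowerSeries.
Variable R : comUnitRingType.
Implicit Types A B : nat -> R.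

Definition fps_one : nat -> R := fun n => (n == 0%N)%:R.

Definition fps_mul A B : nat -> R :=
  fun n => \sum_(i < n.+1) A i * B (n - i)%N.

Definition fps_exp_nat A k : nat -> R := iter k (fps_mul A) fps_one.

(* The series sum_k A^k / k!, for A with zero constant term: A^k then has no
   coefficient in degree n < k, so that the sum stops at k = n. *)
Definition fps_exp A : nat -> R :=
  fun n => \sum_(k < n.+1) (k`!)%:R^-1 * fps_exp_nat A k n.

(* A(z^i), for i > 0. *)
Definition fps_subst_pow (i : nat) A : nat -> R :=
  fun n => if (i %| n)%N then A (n %/ i)%N else 0.

End PowerSeries.

(** * The series T, D and T_c *)

Definition polya_of_size (n : nat) : set polya :=
  [set T : polya | polya_size T = n]%classic.

(* [fset_set] is only meaningful on finite sets; see [finite_polya_of_size]. *)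
Definition polya_count (n : nat) : nat := #|` fset_set (polya_of_size n)|.

Definition Tser : nat -> rat := fun n => (polya_count n)%:R.

(* The series sum_(i >= 2) T(z^i) / i: as T has zero constant term, T(z^i)
   contributes to the coefficient of z^n only for i <= n. *)
Definition Tser_tail : nat -> rat :=
  fun n => \sum_(2 <= i < n.+1) fps_subst_pow i Tser n / i%:R.

Definition Dser : nat -> rat := fps_exp Tser_tail.

(* The series z u exp(A(z,u)) D(z), for series in z with coefficients in Q[u];
   the variable u is ['X]. *)
Definition Tc_rhs (A : nat -> {poly rat}) : nat -> {poly rat} :=
  fps_mul (fun n => if n == 1%N then 'X else 0)
    (fps_mul (fps_exp A) (fun n => (Dser n)%:P)).

(* The equation defining T_c; see [Tc_exists] and [Tc_unique]. Any solution has
   zero constant term, so that its exponential is meaningful. *)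
Definition Tc_equation (Tc : nat -> {poly rat}) : Prop := Tc =1 Tc_rhs Tc.

(** * The weights *)

Definition tpoly (T : polya) : {poly rat} :=
  (#|rgraph_aut (polya_graph T)|%:R)^-1 *:
    \sum_(s in rgraph_aut (polya_graph T)) 'X^(nfix s).

Definition forest_weight (F : {mset polya}) : rat :=
  #|[set s in rgraph_aut (forest_graph F) | nfix s == 0%N]|%:R
    / #|rgraph_aut (forest_graph F)|%:R.

Definition forests_ge2_of_size (n : nat) : set {mset polya} :=
  [set F : {mset polya} | mset_ge2 F /\ forest_size F = n]%classic.

(** * Well-posedness: the sums are finite, and T_c exists and is unique *)

(* A sum [\sum_(x \in A)] over a set has the intended meaning because A is
   finite: see [finite_polya_of_size] and [finite_forests_ge2_of_size]. *)

Lemma finite_seqs (T : eqType) (s : seq T) n :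
  exists S : seq (seq T), forall u : seq T,
    (size u <= n)%N -> {subset u <= s} -> u \in S.
Proof.
elim: n => [|n [S HS]]; first by exists [:: [::]] => -[].
exists ([::] :: [seq x :: u | x <- s, u <- S]) => -[|x u] //= szu sub.
rewrite inE; apply/allpairsP; exists (x, u) => /=; split=> //.
- by apply: sub; rewrite inE eqxx.
- by apply: HS => // y yu; apply: sub; rewrite inE yu orbT.
Qed.

Lemma card_disjoint_union gs :
  #|disjoint_union gs| = (\sum_(g <- gs) #|vertex g|)%N.
Proof.
rewrite card_tagged sumnE big_map big_enum /=.
by rewrite (big_nth empty_rgraph) big_mkord.
Qed.

Lemma card_tree_graph ts :
  #|tree_graph (Node ts)| = (\sum_(t <- ts) #|tree_graph t|).+1.
Proof. by rewrite card_option card_disjoint_union big_map. Qed.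

Lemma card_tree_graph_gt0 t : (0 < #|tree_graph t|)%N.
Proof. by case: t => ts; rewrite card_tree_graph. Qed.

Lemma leq_size_sum (T : eqType) (s : seq T) (w : T -> nat) :
  (forall x, 0 < w x)%N -> (size s <= \sum_(x <- s) w x)%N.
Proof. by move=> w_gt0; rewrite -sum1_size; apply: leq_sum => x _. Qed.

Lemma leq_mem_sum (T : eqType) (s : seq T) (w : T -> nat) x :
  x \in s -> (w x <= \sum_(y <- s) w y)%N.
Proof. by move=> xs; rewrite (big_rem x) //= leq_addr. Qed.

Lemma finite_trees k :
  exists s : seq tree, forall t, (#|tree_graph t| <= k)%N -> t \in s.
Proof.
elim: k => [|k [s Hs]].
  by exists [::] => t; rewrite leqNgt card_tree_graph_gt0.
have [S HS] := finite_seqs s k.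
exists (map Node S) => -[ts]; rewrite card_tree_graph ltnS => le_k.
apply/map_f/HS.
- by apply: leq_trans le_k; apply: leq_size_sum => t; apply: card_tree_graph_gt0.
- by move=> t /leq_mem_sum /leq_trans tts; apply: Hs; apply: tts le_k.
Qed.

Lemma finite_polya_le k :
  exists s : seq polya, forall T, (polya_size T <= k)%N -> T \in s.
Proof.
have [s Hs] := finite_trees k; exists (map \pi_polya%qT s) => T le_k.
by rewrite -[T]reprK; apply/map_f/Hs.
Qed.

Lemma finite_polya_of_size n : finite_set (polya_of_size n).
Proof.
have [s Hs] := finite_polya_le n.
apply: (@sub_finite_set _ _ [set` s]%classic); last exact: finite_seq.
by move=> T /= eqn; apply: Hs; rewrite eqn.
Qed.

Lemma polya_size_gt0 T : (0 < polya_size T)%N.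
Proof. exact: card_tree_graph_gt0. Qed.

Lemma forest_sizeE F : forest_size F = (\sum_(T <- enum_mset F) polya_size T)%N.
Proof. by rewrite /forest_size card_disjoint_union big_map. Qed.

Lemma finite_forests_ge2_of_size n : finite_set (forests_ge2_of_size n).
Proof.
have [s Hs] := finite_polya_le n; have [S HS] := finite_seqs s n.
apply: (@sub_finite_set _ _ [set` map (@seq_mset polya) S]%classic); last exact: finite_seq.
move=> F /= [_]; rewrite forest_sizeE => szF.
apply/mapP; exists (enum_mset F); last first.
  by rewrite seq_mset_id.
apply: HS; first by rewrite -szF leq_size_sum //; apply: polya_size_gt0.
by move=> T TF; apply: Hs; rewrite -szF leq_mem_sum.
Qed.

Lemma fps_exp_ext (R : comUnitRingType) (A B : nat -> R) n :
  (forall m, (m <= n)%N -> A m = B m) -> fps_exp A n = fps_exp B n.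
Proof.
move=> eqAB; apply: eq_bigr => k _; congr (_ * _).
move: (nat_of_ord k) => {}k; elim: k n eqAB => [//|k IHk] n eqAB; apply: eq_bigr => i _.
rewrite eqAB -1?ltnS //; congr (_ * _); apply: IHk => m le_m.
by apply: eqAB; apply: leq_trans le_m (leq_subr _ _).
Qed.

Lemma Tc_rhs_ext A B n :
  (forall m, (m < n)%N -> A m = B m) -> Tc_rhs A n = Tc_rhs B n.
Proof.
move=> eqAB; apply: eq_bigr => i _; case: eqP => [i1|]; last by rewrite !mul0r.
congr (_ * _); apply: eq_bigr => j _; congr (_ * _).
apply: fps_exp_ext => m le_m; apply: eqAB.
have := ltn_ord j; have := ltn_ord i; rewrite i1 in j le_m *.
by rewrite !ltnS => n_gt0 lej; rewrite -(subnK n_gt0) addn1 ltnS; apply: leq_trans le_m lej.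
Qed.

Lemma Tc_exists : exists Tc, Tc_equation Tc.
Proof.
pose a k := iter k Tc_rhs (fun=> 0).
have a_stable n k l : (n < k)%N -> (n < l)%N -> a k n = a l n.
  elim/ltn_ind: n k l => n IHn [//|k] [//|l] ltk ltl /=.
  by apply: Tc_rhs_ext => m lt_m; apply: IHn => //; apply: leq_trans lt_m _.
exists (fun n => a n.+1 n) => n; rewrite -[RHS]/(Tc_rhs _ n).
by apply: Tc_rhs_ext => m lt_m; apply: a_stable.
Qed.

Lemma Tc_unique A B : Tc_equation A -> Tc_equation B -> A =1 B.
Proof.
move=> solA solB; elim/ltn_ind => n IHn.
by rewrite solA solB; apply: Tc_rhs_ext.
Qed.

(* Main.v *)
Require Import Defs.
From HB Require Import structures.
From mathcomp Require Import all_boot all_order all_algebra perm.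
From mathcomp Require Import fingroup action.
From mathcomp Require Import finmap multiset.
From mathcomp Require Import mathcomp_extra boolp classical_sets functions.
From mathcomp Require Import cardinality fsbigop.
From mathcomp Require Import ring zify.
(* [Defs] again, since [fingraph] has another [rgraph]. *)
Import Defs fintype boot.finset fingroup generic_quotient GRing.Theory.

(** An automorphism of a forest permutes its components. For a component [a], an
automorphism either preserves [a], or sends it to another component [b] of the same
isomorphism class; in the second case, swapping [a] and [b] afterwards gives an
automorphism that preserves [a], and the fixed points lost are those in [b]. The
resulting two-term recurrence shows that the average over [Aut F] of [u^(sigma_1)]
is the product over the trees [T] of [h_(F T)(t_T(u))], where [F T] is the
multiplicity of [T] and [h_m(x) = sum_(j <= m) (x - 1)^j / j!].

From [m h_m(x) = x h_(m-1)(x) + sum_(j < m - 1) h_j(x)] it follows that the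
series [Z] of these averages over all forests satisfies [z Z' = z (S + L)' Z], where
[S] is the sum of [t_T(u) z^|T|] and [L] the sum of [T(z^i) / i] for [i >= 2]. Hence
[Z = exp(S) D]. Planting a forest on a new root multiplies the average by [u],
so that [S = z u Z] solves the equation of [T_c]. At [u = 0], [S] vanishes and
[Z = D]; since [h_1(0) = 0], only the forests without simple trees contribute.

The derivative at [1] of [t_T] counts the orbits of [Aut T] by the
Cauchy-Frobenius formula. *)

Set Implicit Arguments.
Unset Strict Implicit.
Unset Printing Implicit Defensive.
Local Open Scope mset_scope.
Local Open Scope ring_scope.

(** * Automorphisms and isomorphisms *)

Lemma rgraph_autP (X : rgraph) (s : {perm X}) :
  reflect ((forall x y, adj (s x) (s y) = adj x y)
           /\ (forall x, isroot (s x) = isroot x)) (s \in rgraph_aut X).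
Proof.
rewrite inE; apply: (iffP andP) => -[sa sr]; split.
- by move=> x y; move/forallP: sa => /(_ x)/forallP/(_ y)/eqP.
- by move=> x; move/forallP: sr => /(_ x)/eqP.
- by apply/forallP => x; apply/forallP => y; apply/eqP.
- by apply/forallP => x; apply/eqP.
Qed.

Lemma rgraph_aut_group_set (X : rgraph) : group_set (rgraph_aut X).
Proof.
apply/group_setP; split.
  by apply/rgraph_autP; split=> *; rewrite !perm1.
move=> s t /rgraph_autP[sa sr] /rgraph_autP[ta tr]; apply/rgraph_autP.
by split=> *; rewrite !permM ?ta ?tr.
Qed.
Canonical rgraph_aut_group X := Group (rgraph_aut_group_set X).

Lemma card_aut_neq0 X : #|rgraph_aut X|%:R != 0 :> rat.
Proof.
by rewrite (Num.Theory.pnatr_eq0 rat) -lt0n (cardG_gt0 (rgraph_aut_group _)).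
Qed.

(** An isomorphism from [(T, v)] to [(T, w)] is an automorphism of [T] that maps [v] to [w], so the
    classes of pointed vertices are orbits. *)
Lemma pointingsE (T : polya) :
  pointings T = orbit 'P (rgraph_aut (polya_graph T)) @: [set: polya_graph T].
Proof.
apply: eq_in_imset => x _; apply/setP => y; rewrite !inE /=.
apply/asboolP/orbitP.
  case=> f [fb fa fr] fxy; exists (perm (bij_inj fb)).
    by apply/rgraph_autP; split=> *; rewrite !permE.
  by rewrite /= /aperm permE.
case=> s /rgraph_autP[sa sr] <-; exists s => //.
by split=> //; exists (s^-1)%g; [apply: permK | apply: permKV].
Qed.

Lemma tpoly_deriv1 (T : polya) : (tpoly T)^`().[1] = #|pointings T|%:R.
Proof.
set G := rgraph_aut (polya_graph T).
have acts : [acts G, on [set: polya_graph T] | 'P].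
  by apply/subsetP => s _; rewrite !inE; apply/subsetP => x _; rewrite !inE.
rewrite pointingsE derivZ hornerZ; apply: (canLR (mulKf (card_aut_neq0 _))).
rewrite mulrC -natrM -(Frobenius_Cauchy acts) raddf_sum horner_sum natr_sum /=.
apply: eq_bigr => s _; rewrite derivXn hornerMn hornerXn expr1n.
rewrite /nfix; congr (_%:R); apply: eq_card => x.
by rewrite !inE sub1set inE.
Qed.

(** * Fixed-point polynomials of automorphism groups, and planting *)

Definition autpoly (X : rgraph) : {poly rat} :=
  \sum_(s in rgraph_aut X) 'X^(nfix s).

Lemma autpoly1 X : (autpoly X).[1] = #|rgraph_aut X|%:R.
Proof.
rewrite horner_sum -sumr_const; apply: eq_bigr => s _.
by rewrite hornerXn expr1n.
Qed.

Lemma autpoly0 X :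
  (autpoly X).[0] = #|[set s in rgraph_aut X | nfix s == 0%N]|%:R.
Proof.
rewrite horner_sum -sum1_card natr_sum (bigID (fun s => nfix s == 0%N)) /=.
rewrite [X in _ + X]big1 ?addr0 => [|s /andP[_ /negPf s0]].
  rewrite [RHS](eq_bigl (fun s => (s \in rgraph_aut X) && (nfix s == 0%N))).
    by apply: eq_bigr => s /andP[_ /eqP->]; rewrite hornerXn expr0.
  by move=> s; rewrite !inE.
by rewrite hornerXn expr0n s0.
Qed.

(** Conjugation by the isomorphism matches the two groups and carries fixed points to fixed
    points. *)
Lemma autpoly_iso X Y : isomorphic X Y -> autpoly X = autpoly Y.
Proof.
case=> f [[g fK gK] fa fr].
have injh (s : {perm X}) : injective (f \o s \o g).
  by apply: inj_comp (can_inj gK); apply: inj_comp (can_inj fK) perm_inj.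
have injk (s : {perm Y}) : injective (g \o s \o f).
  by apply: inj_comp (can_inj fK); apply: inj_comp (can_inj gK) perm_inj.
rewrite /autpoly (reindex_onto (fun s => perm (injk s)) (fun s => perm (injh s))) /=.
  apply: eq_big => [s|s _].
    rewrite (_ : perm (injh _) == s = true) ?andbT; last first.
      by apply/eqP/permP => y; rewrite !(permE, gK) /= !permE /= !gK.
    apply/rgraph_autP/rgraph_autP => -[sa sr]; split=> x.
    + move=> y; rewrite -[x]gK -[y]gK.
      by have := sa (g x) (g y); rewrite -!fa !permE /= !gK.
    + by rewrite -[x]gK; have := sr (g x); rewrite -!fr !permE /= !gK.
    + by move=> y; rewrite -!fa !permE /= !gK sa.
    + by rewrite -!fr !permE /= !gK sr.
  congr ('X^ _); rewrite /nfix -(card_imset _ (can_inj fK)); apply: eq_card => y.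
  rewrite !inE; apply/imsetP/eqP.
    case=> x; rewrite inE permE /= => /eqP sx ->.
    by rewrite -[in RHS]sx gK.
  by move=> sy; exists (g y); rewrite ?gK // inE permE /= gK sy.
by move=> s _; apply/permP => x; rewrite !permE /= !permE /= !fK.
Qed.

Lemma isomorphic_refl X : isomorphic X X.
Proof. by exists id; split=> //; exists id. Qed.

Lemma isomorphic_trans Y X Z :
  isomorphic X Y -> isomorphic Y Z -> isomorphic X Z.
Proof.
case=> f [fb fa fr] [g [gb ga gr]]; exists (g \o f); split.
- exact: bij_comp.
- by move=> x y; rewrite /= ga fa.
- by move=> x; rewrite /= gr fr.
Qed.

Lemma add_root_iso X Y : isomorphic X Y -> isomorphic (add_root X) (add_root Y).
Proof.
case=> f [[g fK gK] fa fr]; exists (omap f); split.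
- by exists (omap g); case=> //= x; rewrite ?fK ?gK.
- by case=> [x|] [y|] //=.
- by case.
Qed.

(** [None] is the only root on both sides, so the isomorphism fixes it and restricts to the other
    vertices. The roots of [X] and [Y] are recovered as the neighbours of [None]. *)
Lemma add_root_isoV X Y : isomorphic (add_root X) (add_root Y) -> isomorphic X Y.
Proof.
case=> f [[g fK gK] fa fr].
have fN : f None = None by apply/eqP; have := fr None => /= ->.
have gN : g None = None by rewrite -fN fK.
have fS x : {y | f (Some x) = Some y}.
  case E: (f (Some x)) => [y|]; first by exists y.
  by have := fr (Some x); rewrite E.
have gS y : {x | g (Some y) = Some x}.
  case E: (g (Some y)) => [x|]; first by exists x.
  by have := gK (Some y); rewrite E fN.
exists (fun x => sval (fS x)); split.
- exists (fun y => sval (gS y)) => x.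
    by case: (fS x) => y /= fx; case: (gS y) => z /=; rewrite -fx fK => -[].
  by case: (gS x) => y /= fx; case: (fS y) => z /=; rewrite -fx gK => -[].
- move=> x y; case: (fS x) => x' /= fx; case: (fS y) => y' /= fy.
  by have := fa (Some x) (Some y); rewrite fx fy.
- move=> x; case: (fS x) => x' /= fx.
  by have := fa (Some x) None; rewrite fx fN.
Qed.

(** An automorphism fixes [None] and preserves its neighbours, the roots of [G]. Hence it is [omap]
    of an automorphism of [G], with one more fixed point. *)
Lemma autpoly_add_root G : autpoly (add_root G) = 'X * autpoly G.
Proof.
have injl (s : {perm G}) : injective (omap s).
  by case=> [x|] [y|] //= [/perm_inj ->].
pose l s : {perm add_root G} := perm (injl s).
have lE s x : l s x = omap s x by rewrite permE.
have -> : autpoly (add_root G) =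
    \sum_(s in l @: rgraph_aut G) 'X^(nfix s).
  apply: eq_bigl => s; apply/idP/imsetP; last first.
    case=> t /rgraph_autP[ta tr] ->; apply/rgraph_autP; split.
      by case=> [x|] [y|]; rewrite !lE //=.
    by case=> [x|]; rewrite !lE //=.
  move=> /rgraph_autP[sa sr].
  have sN : s None = None by apply/eqP; have := sr None => /= ->.
  have sS x : {y | s (Some x) = Some y}.
    case E: (s (Some x)) => [y|]; first by exists y.
    by have := sr (Some x); rewrite E.
  have tinj : injective (fun x => sval (sS x)).
    move=> x y; case: (sS x) => x' /= sx; case: (sS y) => y' /= sy xy.
    by apply/Some_inj/(@perm_inj _ s); rewrite sx sy xy.
  have tE x : s (Some x) = Some (perm tinj x) by rewrite permE; case: (sS x).
  exists (perm tinj); last first.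
    by apply/permP => -[x|]; rewrite lE //= -tE.
  apply/rgraph_autP; split=> [x y|x].
    by have := sa (Some x) (Some y); rewrite !tE.
  by have := sa (Some x) None; rewrite !tE sN.
rewrite big_imset => [|s t _ _ /permP st]; last first.
  by apply/permP => x; apply/Some_inj; have := st (Some x); rewrite !lE.
rewrite big_distrr; apply: eq_bigr => s _ /=; rewrite -exprS; congr ('X^ _).
rewrite /nfix (cardD1 None) inE lE eqxx add1n; congr _.+1.
rewrite -(card_imset _ (@Some_inj _)).
apply: eq_card => -[x|].
  rewrite !inE lE /=; apply/eqP/imsetP; first by case=> sx; exists x; rewrite ?inE ?sx.
  by case=> y; rewrite inE => /eqP sy [->]; rewrite sy.
by rewrite !inE; apply/esym/negbTE/negP => /imsetP[].
Qed.

Lemma polya_isoP (T U : polya) :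
  isomorphic (polya_graph T) (polya_graph U) -> T = U.
Proof.
move=> TU; rewrite -[T]reprK -[U]reprK; apply/eqquotP.
exact/asboolP.
Qed.

Lemma polya_graph_pi (t : tree) : isomorphic (polya_graph (\pi t)%qT) (tree_graph t).
Proof.
apply/asboolP; change (is_true (tree_iso (repr (\pi_polya%qT t)) t)).
apply/eqquotP; exact: reprK.
Qed.

(** * Disjoint unions and their components *)

(** Like [disjoint_union], but over any finite index type, so that the components are given by a
    function rather than as entries of a list. *)
Definition dunion (I : finType) (G : I -> rgraph) : rgraph :=
  @RGraph {i : I & G i}
    (fun x y => (tag x == tag y) && adj (tagged x) (tagged_as x y))
    (fun x => isroot (tagged x)).

Definition dinj (I : finType) (G : I -> rgraph) i (x : G i) : dunion G :=
  Tagged (fun i => vertex (G i)) x.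

Definition dtag (I : finType) (G : I -> rgraph) (x : dunion G) : I := tag x.

Lemma dinj_inj (I : finType) (G : I -> rgraph) i : injective (@dinj I G i).
Proof. by move=> x y /eqP; rewrite /dinj eq_Tagged => /eqP. Qed.

Lemma dinjP (I : finType) (G : I -> rgraph) (x : dunion G) i :
  dtag x = i -> {y : G i | x = dinj y}.
Proof. by case: x => j y /= <-; exists y. Qed.

Lemma adj_dinj (I : finType) (G : I -> rgraph) i (x y : G i) :
  adj (dinj x) (dinj y) = adj x y.
Proof. by rewrite /dinj /= eqxx tagged_asE. Qed.

Lemma adj_dtag (I : finType) (G : I -> rgraph) (x y : dunion G) :
  adj x y -> dtag x = dtag y.
Proof. by case/andP => /eqP. Qed.

Lemma dunion_iso (I J : finType) (G : I -> rgraph) (H : J -> rgraph) (p : I -> J) :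
  bijective p -> (forall i, isomorphic (G i) (H (p i))) ->
  isomorphic (dunion G) (dunion H).
Proof.
move=> [q pK qK] isoGH.
pose f i := sval (cid (isoGH i)).
have fiso i : rgraph_isom (f i) by rewrite /f; case: cid.
pose F (x : dunion G) : dunion H := dinj (f (tag x) (tagged x)).
have injF : injective F.
  move=> [i x] [j y] eqF; have /(can_inj pK) ij : p i = p j := congr1 tag eqF.
  case: _ / ij in y eqF *; have /= := dinj_inj eqF.
  by have [/bij_inj injf _ _] := fiso i => /injf ->.
have surjF y : exists x, F x = y.
  case: y => j y; have := qK j; move: (q j) => i ij.
  case: _ / ij in y *; have [[g _ gK] _ _] := fiso i.
  by exists (dinj (g y)); rewrite /F /= gK.
have [g gK] := boolp.choice surjF.
exists F; split.
- by exists g => // x; apply: injF; rewrite gK.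
- move=> [i x] [j y]; have [ij|/eqP ij] := eqVneq i j.
    case: _ / ij in y *; rewrite adj_dinj.
    by have [_ fa _] := fiso i; rewrite fa -adj_dinj.
  apply/idP/idP => /adj_dtag //= /(can_inj pK) //.
- by move=> [i x]; have [_ _ fr] := fiso i; rewrite /= fr.
Qed.

Lemma perm_eq_ord_bij (T : eqType) (x0 : T) (s t : seq T) : perm_eq s t ->
  exists2 p : 'I_(size s) -> 'I_(size t), bijective p
    & forall i : 'I_(size s), nth x0 s i = nth x0 t (p i).
Proof.
move=> st; have szst := perm_size st.
have /tuple_permP[p sE] : perm_eq s (in_tuple t) by [].
exists (p \o cast_ord szst).
  apply: bij_comp; first by exists (p^-1)%g; [apply: permK | apply: permKV].
  by exists (cast_ord (esym szst)) => i; [apply: cast_ordK | apply: cast_ordKV].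
move=> i; rewrite {1}sE /=.
rewrite (nth_map (cast_ord szst i)) ?size_enum_ord -?szst //.
rewrite (tnth_nth x0) /=; congr (nth _ _ (p _)).
by apply: val_inj; rewrite /= nth_enum_ord // -szst.
Qed.

Lemma ord_bij_perm_eq (T : eqType) (x0 : T) (s t : seq T)
    (p : 'I_(size s) -> 'I_(size t)) :
  bijective p -> (forall i : 'I_(size s), nth x0 s i = nth x0 t (p i)) -> perm_eq s t.
Proof.
move=> pb sp; apply/allP => x _ /=; apply/eqP.
rewrite -!sum1_count !(big_nth x0) !big_mkord (reindex p) /=; last exact: onW_bij.
by apply: eq_bigl => i; rewrite sp.
Qed.

(* Reachability is enough (no uniqueness of paths): a rooted tree is then a
   connected component of any disjoint union. *)
Definition root_connected (G : rgraph) :=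
  exists2 r : G, isroot r & forall x, connect adj r x.

Lemma tree_root_connected t : root_connected (tree_graph t).
Proof.
move: t; fix IH 1 => -[ts] /=.
(* The inner induction on [ts] keeps each call of [IH] on a structural subterm, as the guard
   condition demands. *)
have Hts i : (i < size ts)%N -> root_connected (nth empty_rgraph (map tree_graph ts) i).
  elim: ts i => //= t ts IHts [|i]; last exact: IHts.
  by move=> _ /=; apply: IH.
exists None => // -[[i x]|]; last exact: connect0.
have szi : (i < size ts)%N by rewrite -(size_map tree_graph).
have [r rr rx] := Hts i szi.
pose inj (y : nth empty_rgraph (map tree_graph ts) i) :
  add_root (disjoint_union (map tree_graph ts)) := Some (dinj y).
apply: (@connect_trans _ _ (inj r)); first exact: connect1.
have /connectP[q qr ->] := rx x.
apply/connectP; exists (map inj q); last by rewrite last_map.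
rewrite path_map (eq_path (e' := adj)) // => y z.
exact: adj_dinj.
Qed.

Lemma polya_root_connected T : root_connected (polya_graph T).
Proof. exact: tree_root_connected. Qed.

Lemma connect_dtag (I : finType) (G : I -> rgraph) (x y : dunion G) :
  connect adj x y -> dtag x = dtag y.
Proof.
by case/connectP=> q + ->; elim: q x => //= z q IHq x /andP[/adj_dtag -> /IHq].
Qed.

(** Every vertex is reached by a path from the root of its component; [f] maps edges to edges, and a
    path never leaves a component. *)
Lemma dunion_iso_dtag (I J : finType) (G : I -> rgraph) (H : J -> rgraph)
    (f : dunion G -> dunion H) :
  (forall i, root_connected (G i)) -> (forall x y, adj (f x) (f y) = adj x y) ->
  forall x y, dtag x = dtag y -> dtag (f x) = dtag (f y).
Proof.
move=> conG fa.
have conn i (r x : G i) : connect adj r x -> dtag (f (dinj r)) = dtag (f (dinj x)).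
  pose h (y : G i) := f (dinj y).
  case/connectP => q rq ->; apply: connect_dtag; apply/connectP.
  exists (map h q); last exact: esym (last_map h q r).
  rewrite -[f _]/(h r) path_map; move: rq; apply: sub_path => y z yz.
  by change (is_true (adj (h y) (h z))); rewrite fa adj_dinj.
have aux i (r : G i) : (forall z, connect adj r z) ->
    forall x, dtag x = i -> dtag (f x) = dtag (f (dinj r)).
  by move=> rc x /dinjP[z ->]; rewrite -(conn _ r z (rc z)).
by move=> x y xy; have [r _ /aux aux'] := conG (dtag y); rewrite !aux'.
Qed.

(** Both [f] and its inverse respect components, so they induce mutually inverse maps [p] and [q] on
    the indices. The roots serve as base points to define these maps. *)
Lemma dunion_isoV (I J : finType) (G : I -> rgraph) (H : J -> rgraph)
    (f : dunion G -> dunion H) :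
  (forall i, root_connected (G i)) -> (forall j, root_connected (H j)) ->
  rgraph_isom f ->
  exists p : I -> J, [/\ bijective p, forall x, dtag (f x) = p (dtag x)
    & forall i, isomorphic (G i) (H (p i))].
Proof.
move=> conG conH [[g fK gK] fa fr].
have fT := dunion_iso_dtag conG fa.
have ga x y : adj (g x) (g y) = adj x y by rewrite -fa !gK.
have gT := dunion_iso_dtag conH ga.
have rG i : {r : G i | isroot r} by apply: cid; case: (conG i) => r; exists r.
have rH j : {r : H j | isroot r} by apply: cid; case: (conH j) => r; exists r.
pose p i := dtag (f (dinj (sval (rG i)))).
pose q j := dtag (g (dinj (sval (rH j)))).
have pE i (x : G i) : dtag (f (dinj x)) = p i by apply: fT.
have qE j (y : H j) : dtag (g (dinj y)) = q j by apply: gT.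
have pK : cancel p q.
  move=> i; rewrite -(qE _ (tagged (f (dinj (sval (rG i)))))).
  by rewrite (_ : dinj _ = f (dinj (sval (rG i)))) ?fK //; case: (f _).
have qK : cancel q p.
  move=> j; rewrite -(pE _ (tagged (g (dinj (sval (rH j)))))).
  by rewrite (_ : dinj _ = g (dinj (sval (rH j)))) ?gK //; case: (g _).
exists p; split; [by exists q | by case=> i x; apply: pE | move=> i].
have fi (x : G i) : {y : H (p i) | f (dinj x) = dinj y} by apply/dinjP/pE.
have gi (y : H (p i)) : {x : G i | g (dinj y) = dinj x}.
  by apply/dinjP; rewrite qE pK.
exists (fun x => sval (fi x)); split.
- exists (fun y => sval (gi y)) => x.
    by case: (fi x) => y /= fx; case: (gi y) => z /=; rewrite -fx fK => /dinj_inj.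
  by case: (gi x) => y /= gx; case: (fi y) => z /=; rewrite -gx gK => /dinj_inj.
- move=> x y; case: (fi x) => x' /= fx; case: (fi y) => y' /= fy.
  by rewrite -adj_dinj -fx -fy fa adj_dinj.
- move=> x; case: (fi x) => x' /= fx.
  by have := fr (dinj x); rewrite fx.
Qed.

(** * Fixed points of permutations of the components *)

(* [m! * \sum_(j <= m) y ^ j / j!]; for [y = x - 1], this is the sum of [x ^ nfix s]
   over the permutations [s] of [m] points. *)
Fixpoint exp_fact (R : nzRingType) (y : R) m : R :=
  if m is m'.+1 then m%:R * exp_fact y m' + y ^+ m else 1.

(* [p] maps a vertex to its component, [r] chooses a vertex in each component, and
   [c] gives the isomorphism class of a component. *)
Section ComponentPermutations.
Variables (V I : finType) (K : eqType) (p : V -> I) (r : I -> V) (c : I -> K).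
Variable H : {group {perm V}}.
Hypothesis pr : forall i, p (r i) = i.
Hypothesis H_blocks : forall s x y, s \in H -> p x = p y -> p (s x) = p (s y).
Hypothesis H_color : forall s x, s \in H -> c (p (s x)) = c (p x).
Hypothesis H_restrict : forall s a, s \in H ->
  (forall x, p x = a -> p (s x) = a) ->
  exists2 t, t \in H & forall x, t x = if p x == a then s x else x.
Hypothesis H_swap : forall a b, a != b -> c a = c b ->
  exists t, [/\ t \in H, forall x, p (t x) = tperm a b (p x)
    & forall x, p x != a -> p x != b -> t x = x].
Variables (R : comNzRingType) (u : R).
Implicit Types (A C : {set I}) (s t : {perm V}).

Definition nfix_in s A := #|[set x | (p x \in A) && (s x == x)]|.

(** For the automorphism group [H] of a forest, this is the automorphism group of the subforest with
    components [A], kept as permutations of [V] so that no type depends on [A]. *)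
Definition moving A := [set s in H | [forall x, (p x \notin A) ==> (s x == x)]].

Lemma movingP A s :
  reflect (s \in H /\ forall x, p x \notin A -> s x = x) (s \in moving A).
Proof.
rewrite inE; apply: (iffP andP) => -[sH sA]; split=> //.
  by move=> x xA; move/forallP/(_ x): sA; rewrite xA => /eqP.
by apply/forallP => x; apply/implyP => /sA ->.
Qed.

Lemma moving_group_set A : group_set (moving A).
Proof.
apply/group_setP; split; first by apply/movingP; split=> // x; rewrite perm1.
move=> s t /movingP[sH sA] /movingP[tH tA]; apply/movingP; split.
  exact: groupM.
by move=> x xA; rewrite permM sA // tA.
Qed.
Canonical moving_group A := Group (moving_group_set A).

Lemma moving_stable A s x : s \in moving A -> p x \in A -> p (s x) \in A.
Proof.
case/movingP=> sH sA xA; case: (boolP (p (s x) \in A)) => // /[dup] sxA.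
by move/sA/perm_inj => sx; rewrite sx xA in sxA.
Qed.

Lemma blocksV s x y : s \in H -> p (s x) = p (s y) -> p x = p y.
Proof.
by move=> sH /(H_blocks (groupVr sH)); rewrite !permK.
Qed.

Definition weight A := \sum_(s in moving A) u ^+ nfix_in s A.

(** An element of [moving A] that preserves the component [a] is uniquely a product of one supported
    on [a] and one supported on the rest. The base [v] is separate from [u] because [v = 1] merely
    counts on [a]; the set [C] allows fixed points in part of the rest to be ignored. *)
Lemma weight_split a A C (v : R) : a \in A -> C \subset A :\ a ->
  \sum_(s in moving A | p (s (r a)) == a)
     v ^+ nfix_in s [set a] * u ^+ nfix_in s C
  = (\sum_(s in moving [set a]) v ^+ nfix_in s [set a])
    * (\sum_(s in moving (A :\ a)) u ^+ nfix_in s C).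
Proof.
move=> aA /subsetP CA; rewrite big_distrlr pair_big /=.
pose h (q : {perm V} * {perm V}) := (q.1 * q.2)%g.
pose S := [set q | (q.1 \in moving [set a]) && (q.2 \in moving (A :\ a))].
have h1 q x : q \in S -> p x = a -> h q x = q.1 x.
  rewrite inE => /andP[q1 /movingP[_ q2]] xa; rewrite permM q2 // !inE.
  have := moving_stable (x := x) q1; rewrite !inE xa eqxx => /(_ isT) /eqP->.
  by rewrite eqxx.
have h2 q x : q \in S -> p x != a -> h q x = q.2 x.
  rewrite inE => /andP[/movingP[_ q1] _] xa; rewrite permM q1 //.
  by rewrite !inE xa.
transitivity (\sum_(s in h @: S) v ^+ nfix_in s [set a] * u ^+ nfix_in s C).
  apply: eq_bigl => s; apply/andP/imsetP.
    case=> /movingP[sH sA] /eqP sa.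
    have saa x : p x = a -> p (s x) = a.
      by move=> xa; rewrite -[RHS]sa; apply: H_blocks; rewrite ?pr.
    have [t tH tE] := H_restrict sH saa.
    have ta : t \in moving [set a].
      by apply/movingP; split=> // x; rewrite inE tE => /negPf ->.
    (* The first factor [t] agrees with [s] on [a], so that the second one is trivial there. *)
    exists (t, (t^-1 * s)%g); last by rewrite /h /= mulKVg.
    rewrite inE ta; apply/movingP; split; first by rewrite groupM ?groupV.
    move=> x; rewrite !inE negb_and negbK permM.
    have [xa _|xa /= xA] := eqVneq (p x) a.
      have : p ((t^-1)%g x) \in [set a].
        by apply: moving_stable; [rewrite groupV | rewrite inE xa].
      by rewrite inE => ya; rewrite -[RHS](permKV t) tE ya.
    have -> : (t^-1)%g x = x by apply: (canLR (permK t)); rewrite tE (negPf xa).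
    exact: sA.
  case=> q qS ->; split.
    move: (qS); rewrite inE => /andP[/movingP[q1H q1] /movingP[q2H q2]].
    apply/movingP; split; first exact: groupM.
    move=> x xA; have xa : p x != a by apply: contraNneq xA => ->.
    by rewrite h2 // q2 // !inE (negPf xA) andbF.
  rewrite h1 // ?pr //; move: qS; rewrite inE => /andP[q1 _].
  by have := moving_stable (x := r a) q1; rewrite !inE pr; apply.
rewrite big_imset /=; last first.
  move=> q q' qS q'S hqq'; have q1 : q.1 = q'.1.
    apply/permP => x; have [xa|xa] := eqVneq (p x) a.
      by rewrite -!h1 // hqq'.
    move: qS q'S; rewrite [q \in S]inE [q' \in S]inE =>
      /andP[/movingP[_ q1] _] /andP[/movingP[_ q'1] _].
    by rewrite q1 ?q'1 // inE.
  apply: injective_projections => //.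
  by move: hqq'; rewrite /h q1 => /mulgI.
apply: eq_big => [q|q qS]; first by rewrite inE.
congr (_ ^+ _ * _ ^+ _); apply: eq_card => x; rewrite !inE.
  by case: eqP => //= xa; rewrite h1.
case: (boolP (p x \in C)) => //= /CA; rewrite !inE => /andP[xa _].
by rewrite h2.
Qed.

Lemma nfix_in_rem s a A : a \in A ->
  nfix_in s A = (nfix_in s [set a] + nfix_in s (A :\ a))%N.
Proof.
move=> aA; rewrite /nfix_in -!sum1dep_card (bigID (fun x => p x == a)) /=.
congr (_ + _)%N; apply: eq_bigl => x; rewrite !inE.
  by have [->|] := eqVneq (p x) a; rewrite ?aA ?andbT ?andbF.
by rewrite andbC andbA.
Qed.

Lemma nfix_in_moved s a : s \in H -> p (s (r a)) != a -> nfix_in s [set a] = 0%N.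
Proof.
move=> sH sa; apply: eq_card0 => x; rewrite !inE; apply/negbTE.
apply: contra sa => /andP[/eqP xa /eqP sx].
by rewrite (H_blocks (y := x)) ?pr ?sx ?xa.
Qed.

Lemma sum_moving1 a :
  \sum_(s in moving [set a]) 1 ^+ nfix_in s [set a] = #|moving [set a]|%:R :> R.
Proof. by rewrite -sumr_const; apply: eq_bigr => s _; rewrite expr1n. Qed.

(** An element that moves [b] has no fixed point in it, so leaving [b] out of the exponent changes
    nothing. For those that preserve [b], the factor [weight [set b]] is replaced by the order of
    [moving [set b]]. *)
Lemma weight_exclude b A : b \in A ->
  \sum_(s in moving A) u ^+ nfix_in s (A :\ b)
  = weight A - (weight [set b] - #|moving [set b]|%:R) * weight (A :\ b).
Proof.
move=> bA; have Hs s : s \in moving A -> s \in H by case/movingP.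
have split1 := weight_split u bA (subxx _).
have split2 := weight_split 1 bA (subxx _).
rewrite {1}/weight [in LHS](bigID (fun s => p (s (r b)) == b)) /=.
rewrite [X in _ = X - _](bigID (fun s => p (s (r b)) == b)) /=.
have -> : \sum_(s in moving A | p (s (r b)) == b) u ^+ nfix_in s (A :\ b)
    = #|moving [set b]|%:R * weight (A :\ b).
  rewrite -sum_moving1 -split2; apply: eq_bigr => s _.
  by rewrite expr1n mul1r.
have -> : \sum_(s in moving A | p (s (r b)) == b) u ^+ nfix_in s A
    = weight [set b] * weight (A :\ b).
  rewrite -split1; apply: eq_bigr => s _.
  by rewrite (nfix_in_rem _ bA) exprD.
have -> : \sum_(s in moving A | p (s (r b)) != b) u ^+ nfix_in s (A :\ b)
    = \sum_(s in moving A | p (s (r b)) != b) u ^+ nfix_in s A.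
  apply: eq_bigr => s /andP[/Hs sH sb].
  by rewrite (nfix_in_rem _ bA) nfix_in_moved.
ring.
Qed.

(** With [t] the swap, [s * t] sends [a] to [b] exactly when [s] preserves [a]. The product has no
    fixed point in [a] or [b], and elsewhere it has those of [s]; then [weight_split] applies with
    [v = 1]. *)
Lemma weight_moved a b A : a \in A -> b \in A -> a != b -> c a = c b ->
  \sum_(s in moving A | p (s (r a)) == b) u ^+ nfix_in s A
  = #|moving [set a]|%:R * \sum_(s in moving (A :\ a)) u ^+ nfix_in s (A :\ a :\ b).
Proof.
move=> aA bA ab cab; have [t [tH tp tid]] := H_swap ab cab.
have tA : t \in moving A.
  apply/movingP; split=> // x xA.
  by apply: tid; [move: aA | move: bA]; apply: contraTneq => <-.
rewrite -sum_moving1 -weight_split ?subsetDl //.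
rewrite (reindex_inj (mulIg t)) /=; apply: eq_big => s.
  rewrite groupMr // permM tp; congr (_ && _).
  by rewrite -[X in _ == X](tpermL a b) (inj_eq perm_inj).
move=> /andP[]; rewrite groupMr // permM tp => /movingP[sH _].
rewrite -[X in _ == X](tpermL a b) (inj_eq perm_inj) => /eqP sa.
rewrite expr1n mul1r; congr (_ ^+ _); apply: eq_card => x.
rewrite !inE permM; have [xb|xb] := eqVneq (p x) b; rewrite ?andbF /=.
  (* A vertex of [b] fixed by [s * t] would be sent by [s] into [a], but only vertices of [a] go
     there. *)
  apply/negbTE; rewrite negb_and; apply/orP; right.
  apply: contraNneq ab => tsx; have := tp (s x).
  rewrite tsx xb -[X in X = _](tpermL a b) => /perm_inj asx.
  by have := blocksV sH (etrans sa asx); rewrite pr xb => ->.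
have [xa|xa] := eqVneq (p x) a; rewrite ?andbF /=.
  apply/negbTE; rewrite negb_and; apply/orP; right.
  apply: contraNneq ab => tsx; have := tp (s x).
  by rewrite tsx xa (H_blocks (y := r a) sH) ?pr // sa tpermL => ->.
by congr (_ && _); rewrite -{2}[x]tid // (inj_eq perm_inj).
Qed.

(** Sum over the component [b] to which [a] is sent. The case [b = a] gives the product; any other
    [b] has the class of [a], and [weight_moved] followed by [weight_exclude] gives its term. *)
Lemma weight_rec a A : a \in A ->
  weight A = weight [set a] * weight (A :\ a)
    + \sum_(b in A :\ a | c b == c a) #|moving [set a]|%:R *
       (weight (A :\ a)
        - (weight [set b] - #|moving [set b]|%:R) * weight (A :\ a :\ b)).
Proof.
move=> aA; have Hs s : s \in moving A -> s \in H by case/movingP.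
rewrite {1}/weight (partition_big (fun s => p (s (r a))) (mem A)) /=; last first.
  by move=> s /moving_stable; apply; rewrite pr.
rewrite (bigD1 a) //=; congr (_ + _).
  rewrite -weight_split //; apply: eq_bigr => s _.
  by rewrite (nfix_in_rem _ aA) exprD.
rewrite [LHS](eq_bigl (fun b => b \in A :\ a)); last by move=> b; rewrite !inE andbC.
rewrite (bigID (fun b => c b == c a)) /= [X in _ + X]big1 ?addr0.
  apply: eq_bigr => b /andP[bA /eqP cab].
  rewrite -weight_exclude //; move: bA; rewrite !inE => /andP[ba bA].
  by rewrite weight_moved // eq_sym.
move=> b /andP[_ cb]; apply: big_pred0 => s; apply/negbTE/negP => /andP[/Hs sH /eqP sa].
by move/negP: cb; apply; rewrite -sa (H_color _ sH) pr.
Qed.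

(** [n i] stands for the order of the group of one component, and [t (c i)] for the average over it,
    which depends on the class only. *)
Variables (t : K -> R) (n : I -> R).
Hypothesis weight1 : forall i, weight [set i] = n i * t (c i).
Hypothesis moving1 : forall i, #|moving [set i]|%:R = n i.

(** This is the recurrence of [weight_rec] for [m.+1] single points of the same class, with [1 + y]
    as the weight of a point. *)
Lemma exp_fact_rec (y : R) m :
  exp_fact y m.+1 = (1 + y) * exp_fact y m + m%:R * (exp_fact y m - y * exp_fact y m.-1).
Proof.
(* For [m = 0] the predecessor [m.-1] is a default value, multiplied by 0. *)
case: m => [|m]; first by rewrite /= mul0r addr0 !mulr1 expr1.
rewrite [LHS]/= [in RHS]/=; set g := exp_fact y m; set Y := y ^+ m.+1.
rewrite exprS -/Y -[m.+2%:R]natr1; set M := m.+1%:R.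
ring.
Qed.

(** Apart from the product of the [n i], removing a component affects only the factor of its class,
    and on that factor [weight_rec] becomes [exp_fact_rec]. *)
Lemma weight_prod (ks : seq K) A : uniq ks -> (forall i, c i \in ks) ->
  weight A = (\prod_(i in A) n i)
    * \prod_(k <- ks) exp_fact (t k - 1) #|[set i in A | c i == k]|.
Proof.
move=> uks cks; move: {2}#|A| (leqnn #|A|) => N.
elim: N A => [|N IHN] A.
  rewrite leqn0 cards_eq0 => /eqP->; rewrite /weight.
  rewrite big_set0 mul1r [RHS]big1 => [|k _]; last first.
    by rewrite (_ : #|_| = 0%N) //; apply: eq_card0 => i; rewrite !inE.
  rewrite (big_pred1 1%g) => [|s].
    by rewrite (_ : nfix_in _ _ = 0%N) //; apply: eq_card0 => i; rewrite !inE.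
  apply/movingP/eqP => [[_ sid]|->]; first by apply/permP => x; rewrite sid ?inE ?perm1.
  by split=> // x _; rewrite perm1.
have [->|[a aA]] := set_0Vmem A; first by move=> _; apply: IHN; rewrite cards0.
rewrite (cardsD1 a) aA ltnS => szA.
pose E := \prod_(k <- ks | k != c a) exp_fact (t k - 1) #|[set i in A | c i == k]|.
pose m := #|[set i in A :\ a | c i == c a]|.
have mA : #|[set i in A | c i == c a]| = m.+1.
  rewrite (cardsD1 a) !inE aA eqxx; congr _.+1; apply: eq_card => i.
  by rewrite !inE andbA.
have Wa : weight (A :\ a) = (\prod_(i in A :\ a) n i) * (exp_fact (t (c a) - 1) m * E).
  rewrite IHN // (bigD1_seq (c a)) //=; congr (_ * (_ * _)).
  apply: eq_bigr => k ka; congr (exp_fact _ _); apply: eq_card => i; rewrite !inE.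
  by have [->|//] := eqVneq i a; rewrite eq_sym (negPf ka) !andbF.
(* The factor [n b] restores the one missing from the product over [A :\ a :\ b]. Here [m] is
   positive, as [b] is counted in it. *)
have Wb b : b \in A :\ a -> c b == c a -> n b * weight (A :\ a :\ b) =
    (\prod_(i in A :\ a) n i) * (exp_fact (t (c a) - 1) m.-1 * E).
  move=> bA /eqP cba; rewrite IHN; last first.
    by apply: leq_trans szA; rewrite subset_leq_card // subsetDl.
  rewrite mulrA [in RHS](big_setD1 b bA) /= (bigD1_seq (c a)) //=.
  congr (_ * (exp_fact _ _ * _)).
    rewrite /m [in RHS](cardsD1 b) inE bA cba eqxx /=; apply: eq_card => i.
    by rewrite !inE !andbA.
  apply: eq_bigr => k ka; congr (exp_fact _ _); apply: eq_card => i; rewrite !inE.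
  have [->|_] := eqVneq i b; first by rewrite cba [c a == k]eq_sym (negPf ka) !andbF.
  by have [->|//] := eqVneq i a; rewrite eq_sym (negPf ka) !andbF.
rewrite (weight_rec aA) weight1 moving1.
(* The summand does not depend on [b], and there are [m] choices of [b]. *)
rewrite [X in _ + X = _](eq_bigr (fun=> n a * ((\prod_(i in A :\ a) n i) * (E *
   (exp_fact (t (c a) - 1) m - (t (c a) - 1) * exp_fact (t (c a) - 1) m.-1))))); last first.
  move=> b /andP[bA cba]; rewrite weight1 moving1 (eqP cba) Wa; congr (_ * _).
  transitivity ((\prod_(i in A :\ a) n i) * (exp_fact (t (c a) - 1) m * E)
      - (t (c a) - 1) * (n b * weight (A :\ a :\ b))); first by ring.
  by rewrite Wb //; ring.
rewrite sumr_const (_ : #|_| = m); last first.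
  by apply: eq_card => i; rewrite !inE unfold_in !inE.
rewrite -mulr_natl Wa (big_setD1 a aA) /= (bigD1_seq (c a)) //= mA -/E exp_fact_rec.
ring.
Qed.

End ComponentPermutations.

(** * Automorphisms of forests *)

Section Transport.
Variables (I : finType) (c : I -> polya).
Local Notation G := (fun i => polya_graph (c i)).

(** Components of the same class have vertex types that are provably equal but not convertible. *)
Definition polya_cast (T U : polya) (e : T = U) : polya_graph T -> polya_graph U :=
  let: erefl := e in id.

Lemma polya_cast_isom T U (e : T = U) : rgraph_isom (polya_cast e).
Proof. by case: U / e; split=> //; exists id. Qed.

(** Casts, unlike arbitrarily chosen isomorphisms, leave every vertex fixed in the components that
    [p] fixes, as [forest_swap] requires. *)
Definition transport (p : I -> I) (e : forall i, c i = c (p i)) (x : dunion G) : dunion G :=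
  dinj (G := G) (polya_cast (e (tag x)) (tagged x)).

Lemma transport_id p e x : p (dtag x) = dtag x -> @transport p e x = x.
Proof.
(* For an index fixed by [p], the cast is along a proof of [c i = c i], and such a proof is trivial
   because equality on [polya] is decidable. *)
case: x => i x /= pi; rewrite /transport /=; move: (e i); rewrite pi => ei.
by rewrite (eq_axiomK ei).
Qed.

Lemma transport_isom (p : {perm I}) e : rgraph_isom (@transport p e).
Proof.
have injt : injective (@transport p e).
  move=> [i x] [j y] eqt; have ij : i = j.
    by apply: (@perm_inj _ p); apply: (congr1 tag eqt).
  case: _ / ij in y eqt *; have [/= /bij_inj inj _ _] := polya_cast_isom (e i).
  by have /inj /= -> := @dinj_inj I G (p i) _ _ eqt.
split.
- exact: injF_bij.
- move=> [i x] [j y]; have [ij|/eqP ij] := eqVneq i j.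
    case: _ / ij in y *; have [_ casta _] := polya_cast_isom (e i).
    by rewrite [LHS](adj_dinj (G := G)) casta [RHS](adj_dinj (G := G)).
  by apply/idP/idP => /adj_dtag //= /perm_inj.
- move=> [i x]; have [_ _ castr] := polya_cast_isom (e i).
  exact: castr.
Qed.

End Transport.

Section Forest.
Variables (I : finType) (c : I -> polya).
Let G i := polya_graph (c i).
Let r i : dunion G := dinj (s2val (cid2 (polya_root_connected (c i)))).
Let H := rgraph_aut_group (dunion G).

Let rcG i : root_connected (G i). Proof. exact: polya_root_connected. Qed.

Let autH s : s \in H -> rgraph_isom s.
Proof.
move=> /rgraph_autP[sa sr]; split=> //.
by exists (s^-1)%g; [apply: permK | apply: permKV].
Qed.

Lemma forest_blocks s x y : s \in H -> dtag x = dtag y -> dtag (s x) = dtag (s y).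
Proof. by move=> /rgraph_autP[sa sr]; apply: dunion_iso_dtag. Qed.

Lemma forest_color s x : s \in H -> c (dtag (s x)) = c (dtag x).
Proof.
move=> /autH sH; have [p [_ sp iso]] := dunion_isoV rcG rcG sH.
by rewrite sp; apply/esym/polya_isoP/iso.
Qed.

(** No edge joins two components, so [s] on [a] and the identity elsewhere can be glued into an
    automorphism. *)
Lemma forest_restrict s a : s \in H -> (forall x, dtag x = a -> dtag (s x) = a) ->
  exists2 t, t \in H & forall x, t x = if dtag x == a then s x else x.
Proof.
move=> sH sa.
(* Injectivity of the glued map needs the converse: only vertices of [a] are sent into [a]. *)
have sa' x : dtag (s x) = a -> dtag x = a.
  move=> sxa; rewrite -(permK s x); have := sa (r a) erefl; rewrite -sxa => /esym.
  by move/(forest_blocks (groupVr sH)); rewrite !permK.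
have injt : injective (fun x => if dtag x == a then s x else x).
  move=> x y; case: eqP => xa; case: eqP => ya //; first exact: perm_inj.
    by move=> sxy; case: ya; rewrite -sxy sa.
  by move=> sxy; case: xa; rewrite sxy sa.
exists (perm injt); last by move=> x; rewrite permE.
case/rgraph_autP: (sH) => sadj sroot; apply/rgraph_autP; split=> x.
  move=> y; rewrite !permE; case: eqP => xa; case: eqP => ya //.
    by apply/idP/idP => /adj_dtag; rewrite ?(sa x) ?xa // => ay; case: ya.
  by apply/idP/idP => /adj_dtag; rewrite ?(sa y) ?ya // => ay; case: xa.
by rewrite permE; case: eqP.
Qed.

Lemma forest_swap a b : a != b -> c a = c b ->
  exists t, [/\ t \in H, forall x, dtag (t x) = tperm a b (dtag x)
    & forall x, dtag x != a -> dtag x != b -> t x = x].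
Proof.
move=> ab cab; have e i : c i = c (tperm a b i) by case: tpermP => [->|->|].
have [/bij_inj ti ta tr] := transport_isom e.
exists (perm ti); split.
- by apply/rgraph_autP; split=> *; rewrite !permE.
- by move=> x; rewrite permE.
- move=> x xa xb; rewrite permE; apply: transport_id.
  by rewrite tpermD // eq_sym.
Qed.

(** The elements supported on [a] are the automorphisms of [G a] extended by the identity; [l] is
    this extension, and it keeps the number of fixed points in [a]. *)
Lemma weight_moving1 a :
  weight (@dtag I G) H 'X [set a] = autpoly (G a).
Proof.
(* [tagged_as] reads [x] as a vertex of [G a]; the vertex [r a] supplies the index and a default
   value, which the test on [dtag x] excludes. *)
pose f (s : G a -> G a) (x : dunion G) : dunion G :=
  if dtag x == a then dinj (s (tagged_as (dinj (tagged (r a))) x)) else x.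
have fE s (x : G a) : f s (dinj x) = dinj (s x).
  by rewrite /f eqxx /dinj tagged_asE.
have fN s x : dtag x != a -> f s x = x by rewrite /f => /negPf->.
have injf (s : {perm G a}) : injective (f s).
  move=> x y; have [/dinjP[x' ->]|xa] := eqVneq (dtag x) a;
    have [/dinjP[y' ->]|ya] := eqVneq (dtag y) a; rewrite ?fE ?fN //.
  - by move/dinj_inj/perm_inj ->.
  - by move=> sxy; rewrite -sxy eqxx in ya.
  - by move=> sxy; rewrite sxy eqxx in xa.
pose l s := perm (injf s).
have lE s (x : G a) : l s (dinj x) = dinj (s x) by rewrite permE fE.
have lN s x : dtag x != a -> l s x = x by move=> xa; rewrite permE fN.
transitivity (\sum_(s in l @: rgraph_aut (G a))
    'X^(nfix_in (@dtag I G) s [set a]) : {poly rat}).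
  apply: eq_bigl => s; apply/movingP/imsetP; last first.
    case=> t /rgraph_autP[ta tr] ->; split; last by move=> x; rewrite inE => /lN.
    apply/rgraph_autP; split=> x.
      move=> y; have [/dinjP[x' ->]|xa] := eqVneq (dtag x) a;
        have [/dinjP[y' ->]|ya] := eqVneq (dtag y) a; rewrite ?lE ?lN ?adj_dinj //.
      - by apply/idP/idP => /adj_dtag /= ay; rewrite -ay eqxx in ya.
      - by apply/idP/idP => /adj_dtag /= ay; rewrite ay eqxx in xa.
    have [/dinjP[x' ->]|xa] := eqVneq (dtag x) a; rewrite ?lE ?lN //.
    exact: tr.
  case=> sH sN; have sa (x : G a) : {y : G a | s (dinj x) = dinj y}.
    apply: dinjP; have sM : s \in moving (@dtag I G) H [set a] by apply/movingP.
    by have := moving_stable (x := dinj x) sM; rewrite !inE eqxx => /(_ isT)/eqP.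
  have injt : injective (fun x => sval (sa x)).
    move=> x y; case: (sa x) => x' /= sx; case: (sa y) => y' /= sy xy.
    by apply/(@dinj_inj I G a)/(@perm_inj _ s); rewrite sx sy xy.
  have tE x : s (dinj x) = dinj (perm injt x) by rewrite permE; case: (sa x).
  exists (perm injt); last first.
    apply/permP => x; have [/dinjP[x' ->]|xa] := eqVneq (dtag x) a; rewrite ?lE ?lN //.
    by rewrite sN // inE.
  case/rgraph_autP: sH => sadj sr; apply/rgraph_autP; split=> x.
    by move=> y; rewrite -adj_dinj -!tE sadj adj_dinj.
  by have := sr (dinj x); rewrite tE.
rewrite big_imset => [|s t _ _ /permP st]; last first.
  by apply/permP => x; apply/(@dinj_inj I G a); rewrite -!lE st.
apply: eq_bigr => s _ /=; congr ('X^ _).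
rewrite /nfix -(card_imset _ (@dinj_inj I G a)); apply: eq_card => x.
rewrite !inE; apply/andP/imsetP.
  case=> /eqP/dinjP[y ->]; rewrite lE => /eqP/dinj_inj sy.
  by exists y; rewrite // inE sy.
by case=> y; rewrite inE => /eqP sy ->; rewrite lE sy.
Qed.

Lemma card_moving1 a : #|moving (@dtag I G) H [set a]| = #|rgraph_aut (G a)|.
Proof.
apply/eqP; rewrite -(Num.Theory.eqr_nat rat) -autpoly1 -weight_moving1 horner_sum.
by rewrite -sumr_const; apply/eqP/eq_bigr => s _; rewrite hornerXn expr1n.
Qed.

(** The whole group is [moving] of all indices, so [weight_prod] applies, with [n i] the order of
    the group of component [i] and [t] the average [tpoly]. *)
Lemma autpoly_dunion (ks : seq polya) : uniq ks -> (forall i, c i \in ks) ->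
  autpoly (dunion G) = (\prod_i #|rgraph_aut (G i)|%:R)
    * \prod_(k <- ks) exp_fact (tpoly k - 1) #|[set i | c i == k]|.
Proof.
move=> uks cks.
have -> : autpoly (dunion G) = weight (@dtag I G) H 'X [set: I].
  apply: eq_big => s.
    by apply/idP/movingP => [sH|[]//]; split=> // x; rewrite inE.
  by move=> _; congr ('X^ _); apply: eq_card => x; rewrite !inE.
rewrite (@weight_prod _ _ _ _ r c _ _ forest_blocks forest_color forest_restrict
  forest_swap _ _ tpoly (fun i => #|rgraph_aut (G i)|%:R) _ _ ks _ uks cks) //.
- congr (_ * _); first by apply: eq_bigl => i; rewrite inE.
  apply: eq_bigr => k _; congr (exp_fact _ _); apply: eq_card => i.
  by rewrite !inE.
- move=> i; rewrite weight_moving1 /tpoly -scalerAr -mulr_natl mulr1 -mul_polyC.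
  by rewrite mulrA -polyC_natr -polyCM mulVf ?card_aut_neq0 // mul1r.
- by move=> i; rewrite card_moving1.
Qed.

End Forest.

(** * Averages over automorphism groups of forests, and truncated exponentials *)

Definition aut_average (X : rgraph) : {poly rat} :=
  (#|rgraph_aut X|%:R)^-1 *: autpoly X.

(** The order of the group is the value of [autpoly] at 1, so equal numerators give equal
    denominators. *)
Lemma aut_average_iso X Y : isomorphic X Y -> aut_average X = aut_average Y.
Proof. by move=> /autpoly_iso XY; rewrite /aut_average -!autpoly1 XY. Qed.

Lemma aut_average_add_root X : aut_average (add_root X) = 'X * aut_average X.
Proof.
by rewrite /aut_average -!autpoly1 autpoly_add_root hornerM hornerX mul1r scalerAr.
Qed.

Lemma tpoly1 T : (tpoly T).[1] = 1.
Proof. by rewrite hornerZ [X in _ * X]autpoly1 mulVf ?card_aut_neq0. Qed.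

(** The exponential of [y] truncated after degree [m], that is, the [h_m(1 + y)] of the
    introduction. *)
Definition exp_trunc (y : {poly rat}) m : {poly rat} := (m`!%:R)^-1 *: exp_fact y m.

Lemma fact_neq0 m : m`!%:R != 0 :> rat.
Proof. by rewrite (Num.Theory.pnatr_eq0 rat) -lt0n fact_gt0. Qed.

Lemma exp_trunc0 y : exp_trunc y 0 = 1.
Proof. by rewrite /exp_trunc invr1 scale1r. Qed.

Lemma exp_truncS y m :
  m.+1%:R *: exp_trunc y m.+1 = m.+1%:R *: exp_trunc y m + (m`!%:R)^-1 *: y ^+ m.+1.
Proof.
rewrite /exp_trunc factS natrM invfM !scalerA mulVKf ?(Num.Theory.pnatr_eq0 rat) //=.
by rewrite scalerDr mulr_natl -scaler_nat scalerA mulrC.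
Qed.

(** The generating function of [exp_trunc y m] in [z] is [exp(y z) / (1 - z)], with logarithmic
    derivative [y + 1 / (1 - z)]. This is the resulting identity of coefficients, checked by
    induction. *)
Lemma exp_trunc_sum y m :
  m.+1%:R *: exp_trunc y m.+1 = (1 + y) * exp_trunc y m + \sum_(j < m) exp_trunc y j.
Proof.
have eS k : exp_trunc y k.+1 = exp_trunc y k + (k.+1)`!%:R^-1 *: y ^+ k.+1.
  have k0 : k.+1%:R != 0 :> rat by rewrite (Num.Theory.pnatr_eq0 rat).
  apply: (scalerI k0).
  by rewrite exp_truncS scalerDr [X in _ = _ + X]scalerA factS natrM invfM mulVKf.
elim: m => [|m IHm].
  by rewrite exp_truncS exp_trunc0 fact0 invr1 expr1 !scale1r mulr1 big_ord0 addr0.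
rewrite big_ord_recr /= exp_truncS -[m.+2%:R]natr1 scalerDl scale1r IHm eS.
rewrite [y ^+ m.+2]exprS -!mul_polyC; ring.
Qed.

(** In this convolution form, [i] will be the number of copies of a tree that are removed from a
    forest. *)
Lemma exp_trunc_rec y m :
  m%:R *: exp_trunc y m
  = \sum_(1 <= i < m.+1) (if i == 1%N then 1 + y else 1) * exp_trunc y (m - i).
Proof.
case: m => [|m]; first by rewrite scale0r big_geq.
rewrite exp_trunc_sum big_ltn // subn1; congr (_ + _).
rewrite !big_add1 /= big_nat_rev -(big_mkord xpredT) /=; apply: eq_big_nat => i /andP[_ im].
by rewrite add0n mul1r; congr exp_trunc; lia.
Qed.

Lemma exp_fact1 (y : {poly rat}) m : y.[1] = 0 -> (exp_fact y m).[1] = m`!%:R.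
Proof.
move=> y1; elim: m => [|m IHm]; first by rewrite hornerC.
by rewrite /= hornerD hornerM IHm horner_exp y1 expr0n addr0 -polyC_natr hornerC -natrM.
Qed.

Lemma disjoint_union_map (T : Type) (x0 : T) (f : T -> rgraph) (s : seq T) :
  isomorphic (disjoint_union (map f s))
    (dunion (fun i : 'I_(size s) => f (nth x0 s i))).
Proof.
apply: (@dunion_iso _ _ _ _ (cast_ord (size_map f s))).
  by exists (cast_ord (esym (size_map f s))) => i; rewrite ?cast_ordK ?cast_ordKV.
move=> i; rewrite (nth_map x0) -?(size_map f) //.
exact: isomorphic_refl.
Qed.

Lemma card_nth_eq (T : eqType) (x0 k : T) (s : seq T) :
  #|[set i : 'I_(size s) | nth x0 s i == k]| = count_mem k s.
Proof.
by rewrite -sum1dep_card -sum1_count (big_nth x0) big_mkord.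
Qed.

Definition polya_leaf : polya := \pi_polya%qT (Node [::]).

Definition mset_nth (F : {mset polya}) (i : 'I_(size F)) : polya := nth polya_leaf F i.

Lemma forest_graph_iso (F : {mset polya}) :
  isomorphic (forest_graph F) (dunion (fun i => polya_graph (@mset_nth F i))).
Proof. exact: disjoint_union_map. Qed.

(** At 1, [tpoly k - 1] vanishes and [autpoly] becomes the order of the group: the orders for the
    components times the factorials of the multiplicities. Dividing by it turns [exp_fact] into
    [exp_trunc]. Trees outside [F] contribute [exp_trunc _ 0 = 1], so one list [ks] can serve many
    forests. *)
Lemma aut_average_forest (F : {mset polya}) (ks : seq polya) :
  uniq ks -> {subset F <= ks} ->
  aut_average (forest_graph F) = \prod_(k <- ks) exp_trunc (tpoly k - 1) (F k).
Proof.
move=> uks Fks; rewrite (aut_average_iso (forest_graph_iso F)).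
have cks i : @mset_nth F i \in ks by apply/Fks/mem_nth.
have autE := autpoly_dunion uks cks.
pose N := (\prod_i #|rgraph_aut (polya_graph (@mset_nth F i))|)%N.
pose P := (\prod_(k <- ks) (F k)`!)%N.
have N0 : N%:R != 0 :> rat.
  by rewrite natr_prod; apply/prodf_neq0 => i _; apply: card_aut_neq0.
have P0 : P%:R != 0 :> rat.
  by rewrite natr_prod prodf_seq_neq0; apply/allP => k _; apply: fact_neq0.
have {}autE : autpoly (dunion (fun i => polya_graph (@mset_nth F i))) =
    N%:R * \prod_(k <- ks) exp_fact (tpoly k - 1) (F k).
  rewrite autE natr_prod; congr (_ * _); apply: eq_bigr => k _.
  by rewrite /mset_nth card_nth_eq count_mem_mset.
have ft k : (tpoly k - 1).[1] = 0 by rewrite hornerD hornerN hornerC tpoly1 subrr.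
rewrite /aut_average -autpoly1 autE hornerM -polyC_natr hornerC horner_prod.
rewrite (eq_bigr (fun k => (F k)`!%:R)) => [|k _]; last by rewrite exp_fact1.
rewrite mul_polyC scalerA -natr_prod -/P invfM mulrAC mulVf // mul1r.
by rewrite /P natr_prod -prodfV scaler_prod.
Qed.

(** * Planting, and the recurrence for the series of forests *)

Definition plant (F : {mset polya}) : polya := \pi_polya%qT (Node (map repr F)).

Lemma isomorphic_card X Y : isomorphic X Y -> #|X| = #|Y|.
Proof. by case=> f [fb _ _]; apply: bij_eq_card fb. Qed.

Lemma plant_graph F : isomorphic (polya_graph (plant F)) (add_root (forest_graph F)).
Proof.
apply: isomorphic_trans (polya_graph_pi _) _; rewrite /= -map_comp.
exact: isomorphic_refl.
Qed.

Lemma polya_size_plant F : polya_size (plant F) = (forest_size F).+1.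
Proof. by rewrite /polya_size (isomorphic_card (plant_graph F)) card_option. Qed.

Lemma tpoly_plant F : tpoly (plant F) = 'X * aut_average (forest_graph F).
Proof.
(* [tpoly] is convertible to [aut_average] of [polya_graph]. *)
by rewrite -aut_average_add_root -(aut_average_iso (plant_graph F)).
Qed.

(** An isomorphism of planted forests restricts to the forests and matches their components up to
    isomorphism, so the two enumerations agree up to order. *)
Lemma plant_inj : injective plant.
Proof.
move=> F F' eqF.
have : isomorphic (forest_graph F) (forest_graph F').
  apply: add_root_isoV; apply: isomorphic_trans (plant_graph F').
  by rewrite -eqF; apply: isomorphic_sym (plant_graph F).
move/(isomorphic_trans (isomorphic_sym (forest_graph_iso F))).
move=> /isomorphic_trans/(_ (forest_graph_iso F')) [f fiso].
have rc G i : root_connected (polya_graph (@mset_nth G i)) by apply: polya_root_connected.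
have [p [pb _ piso]] := dunion_isoV (rc F) (rc F') fiso.
have /eq_seq_msetP : perm_eq F F'.
  by apply: (ord_bij_perm_eq (x0 := polya_leaf) pb) => i; apply/polya_isoP/piso.
by rewrite !seq_mset_id.
Qed.

(** Cutting off the root of a representative leaves its list of subtrees; [F] is the multiset of
    their classes. *)
Lemma plant_surj T : exists F, plant F = T.
Proof.
case E: (repr T) => [ts]; pose F := seq_mset (map \pi_polya%qT ts).
exists F; apply: polya_isoP; apply: isomorphic_trans (plant_graph F) _.
rewrite [polya_graph T]/polya_graph E; apply: add_root_iso.
apply: isomorphic_trans (forest_graph_iso F) _.
apply: isomorphic_sym; apply: isomorphic_trans (disjoint_union_map (Node [::]) _ _) _.
(* The enumeration of [F] may list these classes in another order, hence the matching [p]. *)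
have : perm_eq (map \pi_polya%qT ts) F by rewrite perm_sym perm_eq_seq_mset.
case/(perm_eq_ord_bij polya_leaf) => p pb pE.
pose q (i : 'I_(size ts)) := p (cast_ord (esym (size_map \pi_polya%qT ts)) i).
apply: (@dunion_iso _ _ _ _ q).
  apply: bij_comp pb _; exists (cast_ord (size_map _ ts)) => i.
    exact: cast_ordKV.
  exact: cast_ordK.
move=> i; rewrite /mset_nth -pE /= (nth_map (Node [::])) //.
exact: isomorphic_sym (polya_graph_pi _).
Qed.

Definition forests_of_size n : set {mset polya} :=
  [set F : {mset polya} | forest_size F = n]%classic.

Lemma polya_of_size_plant n :
  polya_of_size n.+1 = (plant @` forests_of_size n)%classic.
Proof.
apply/seteqP; split=> T.
  have [F <-] := plant_surj T; rewrite /polya_of_size /= polya_size_plant => -[sF].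
  by exists F.
by case=> F sF <-; rewrite /polya_of_size /= polya_size_plant sF.
Qed.

Lemma finite_forests_of_size n : finite_set (forests_of_size n).
Proof.
have := finite_preimage (in2W plant_inj) (finite_polya_of_size n.+1).
by apply: sub_finite_set => F; rewrite /preimage /polya_of_size /= polya_size_plant => ->.
Qed.

(** The relation [S = z u Z] in degree [n.+1]. *)
Lemma sum_polya_plant n :
  \sum_(T \in polya_of_size n.+1) tpoly T
  = 'X * \sum_(F \in forests_of_size n) aut_average (forest_graph F).
Proof.
rewrite polya_of_size_plant fsbig_image; last exact: in2W plant_inj.
by rewrite mulr_fsumr; apply: eq_fsbigr => F _; rewrite tpoly_plant.
Qed.

Lemma forest_sizeD (A B : {mset polya}) :
  forest_size (A `+` B) = (forest_size A + forest_size B)%N.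
Proof.
rewrite !forest_sizeE -big_cat; apply: perm_big; apply/allP => T _ /=.
by rewrite count_cat !count_mem_mset msetE2.
Qed.

Lemma forest_size_msetn i T : forest_size (msetn i T) = (i * polya_size T)%N.
Proof. by rewrite forest_sizeE enum_msetn big_nseq iter_addn_0 mulnC. Qed.

(** A common range for the products of [aut_average_forest], valid for all forests of size at most
    [n]. *)
Definition small_polya n : set polya := [set T : polya | (polya_size T <= n)%N]%classic.

Lemma finite_small_polya n : finite_set (small_polya n).
Proof.
have [s Hs] := finite_polya_le n.
by apply: (@sub_finite_set _ _ [set` s]%classic); [move=> T /= /Hs|exact: finite_seq].
Qed.

Lemma mem_small_polya n T : (T \in fset_set (small_polya n)) = (polya_size T <= n)%N.
Proof.
rewrite in_fset_set; last exact: finite_small_polya.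
by apply/idP/idP; rewrite classical_sets.inE.
Qed.

Lemma mem_forests n F : (F \in fset_set (forests_of_size n)) = (forest_size F == n).
Proof.
rewrite in_fset_set; last exact: finite_forests_of_size.
by apply/idP/eqP; rewrite classical_sets.inE.
Qed.

Lemma msubset_msetn (F : {mset polya}) i T : (i <= F T)%N = (msetn i T `<=` F).
Proof.
apply/idP/msubsetP => [iF U|/(_ T)]; rewrite msetnE; last by rewrite eqxx.
by case: eqP => // ->.
Qed.

Lemma sum_small_polya (R : nmodType) n d (f : polya -> R) : (d <= n)%N ->
  \sum_(T <- fset_set (small_polya n) | polya_size T == d) f T
  = \sum_(T \in polya_of_size d) f T.
Proof.
move=> dn; rewrite fsbig_finite; last exact: finite_polya_of_size.
rewrite -[LHS]big_filter; apply: perm_big; apply: uniq_perm.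
- exact/filter_uniq/fset_uniq.
- exact: fset_uniq.
move=> T; rewrite mem_filter mem_small_polya in_fset_set; last exact: finite_polya_of_size.
apply/andP/idP; rewrite classical_sets.inE; first by case=> /eqP.
by move=> Td; split; [apply/eqP | rewrite Td].
Qed.

Section ForestRecurrence.
Variable n : nat.
Let small := fset_set (small_polya n).
Let P F := aut_average (forest_graph F).
Let Z m := \sum_(F \in forests_of_size m) P F.
(** The coefficients of [exp_trunc_rec] for [y = tpoly T - 1]. *)
Let coef T i : {poly rat} := if i == 1%N then tpoly T else 1.

Let ZE m : Z m = \sum_(F <- fset_set (forests_of_size m)) P F.
Proof. by rewrite /Z fsbig_finite //; apply: finite_forests_of_size. Qed.

Let sub_small F : (forest_size F <= n)%N -> {subset F <= small}.
Proof.
move=> Fn T TF; rewrite mem_small_polya; apply: leq_trans Fn.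
by rewrite forest_sizeE leq_mem_sum.
Qed.

Lemma forest_size_small F : (forest_size F <= n)%N ->
  forest_size F = (\sum_(T <- small) F T * polya_size T)%N.
Proof.
move=> /sub_small Fs; rewrite forest_sizeE sum_mset; apply: big_fset_incl.
  by apply/fsubsetP => T; rewrite msuppE => /Fs.
by move=> T _; rewrite msuppE -mset_eq0 => /eqP->.
Qed.

(** [exp_trunc_rec] is applied to the factor of [T] alone: removing [i] copies of [T] lowers its
    multiplicity to [F T - i] and keeps the other factors. *)
Lemma aut_average_rem F T : (forest_size F <= n)%N ->
  (F T)%:R *: P F = \sum_(1 <= i < n.+1 | (i <= F T)%N) coef T i * P (F `\` msetn i T).
Proof.
move=> Fn; have [TF|] := boolP (T \in F); last first.
  rewrite -mset_eq0 => /eqP->; rewrite scale0r big_nat_cond big_pred0 // => i.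
  by case: i => // i; rewrite andbF.
have Ts := sub_small Fn TF.
have FTn : (F T <= n)%N.
  apply: leq_trans Fn; have : (msetn (F T) T `<=` F) by rewrite -msubset_msetn.
  move/msetBDK => FE; rewrite -[X in forest_size X]FE forest_sizeD forest_size_msetn.
  by apply: leq_trans (leq_addl _ _); rewrite leq_pmulr ?polya_size_gt0.
rewrite /P (aut_average_forest (fset_uniq _) (sub_small Fn)) (bigD1_seq T) ?fset_uniq //=.
rewrite scalerAl exp_trunc_rec big_distrl /= [RHS](big_cat_nat (n := (F T).+1)) //=.
rewrite [X in _ = _ + X]big_nat_cond [X in _ = _ + X]big_pred0 ?addr0; last first.
  by move=> i; lia.
rewrite [LHS]big_nat_cond [RHS]big_nat_cond; apply: eq_big.
  by move=> i; apply/idP/idP; lia.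
move=> i /andP[/andP[i1 iF] _].
rewrite -mulrA; congr (_ * _).
  by rewrite /coef addrC subrK.
rewrite (@aut_average_forest _ small) ?fset_uniq //; last first.
  move=> U; rewrite in_msetB => UF; apply: (sub_small Fn).
  by rewrite in_mset; apply: leq_ltn_trans UF.
rewrite (bigD1_seq T) ?fset_uniq //= msetE2 msetnxx; congr (_ * _).
by apply: eq_bigr => U UT; rewrite msetE2 msetnE (negPf UT) subn0.
Qed.

(** Removing [i] copies of [T] is a bijection from the forests with at least [i] copies, with
    inverse the addition of [i] copies. *)
Lemma sum_forests_rem T i :
  \sum_(F <- fset_set (forests_of_size n) | (i <= (F : {mset polya}) T)%N)
      P (F `\` msetn i T)
  = if (i * polya_size T <= n)%N then Z (n - i * polya_size T) else 0.
Proof.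
have sizeF (F : {mset polya}) : (i <= F T)%N ->
    forest_size F = (forest_size (F `\` msetn i T) + i * polya_size T)%N.
  by rewrite msubset_msetn => /msetBDK {1}<-; rewrite forest_sizeD forest_size_msetn.
case: leqP => [le_n|lt_n]; last first.
  rewrite big_seq_cond big_pred0 // => F; rewrite mem_forests; apply/negbTE/negP.
  by case/andP=> /eqP Fn /sizeF; rewrite Fn; lia.
rewrite ZE -[LHS]big_filter -(big_map (fun F : {mset polya} => F `\` msetn i T) xpredT).
apply: perm_big; apply: uniq_perm; last first.
- move=> F; rewrite mem_forests; apply/mapP/eqP.
    case=> F'; rewrite mem_filter mem_forests => /andP[iF /eqP F'n] ->.
    by have := sizeF _ iF; rewrite F'n; lia.
  move=> Fn; exists (msetn i T `+` F); last by rewrite msetDKB.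
  rewrite mem_filter mem_forests forest_sizeD forest_size_msetn Fn subnKC // eqxx andbT.
  by rewrite msetE2 msetnxx leq_addr.
- exact: fset_uniq.
rewrite map_inj_in_uniq ?filter_uniq ?fset_uniq // => F F'.
rewrite !mem_filter !msubset_msetn => /andP[/msetBDK iF _] /andP[/msetBDK iF' _] eqF.
by rewrite -iF -iF' eqF.
Qed.

(** The size [n] of [F] is the sum of [F T * polya_size T], and [aut_average_rem] expands the term
    of each [T]. Grouping by the removed size [j = i * polya_size T] gives the convolution, where
    [i = 1] yields the tree series and [i >= 2] the tail. *)
Lemma forests_recurrence :
  n%:R *: Z n = \sum_(1 <= j < n.+1)
    (j%:R *: (\sum_(T \in polya_of_size j) tpoly T + (Tser_tail j)%:P)) * Z (n - j).
Proof.
transitivity (\sum_(T <- small) \sum_(1 <= i < n.+1)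
    (polya_size T)%:R *: coef T i *
      (if (i * polya_size T <= n)%N then Z (n - i * polya_size T) else 0)).
  rewrite ZE scaler_sumr.
  transitivity (\sum_(F <- fset_set (forests_of_size n)) \sum_(T <- small)
     (polya_size T)%:R *: ((F T)%:R *: P F)).
    rewrite [LHS]big_seq [RHS]big_seq; apply: eq_bigr => F; rewrite mem_forests => /eqP Fn.
    rewrite -{1}Fn forest_size_small ?Fn // natr_sum scaler_suml; apply: eq_bigr => T _.
    by rewrite scalerA natrM mulrC.
  rewrite exchange_big /=; apply: eq_bigr => T _.
  rewrite -scaler_sumr.
  transitivity ((polya_size T)%:R *: \sum_(F <- fset_set (forests_of_size n))
      \sum_(1 <= i < n.+1 | (i <= F T)%N) coef T i * P (F `\` msetn i T)).
    congr (_ *: _); rewrite [LHS]big_seq [RHS]big_seq; apply: eq_bigr => F.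
    by rewrite mem_forests => /eqP Fn; rewrite aut_average_rem ?Fn.
  rewrite (exchange_big_dep xpredT) //= scaler_sumr; apply: eq_bigr => i _.
  by rewrite -big_distrr sum_forests_rem scalerAl.
transitivity (\sum_(1 <= j < n.+1) (\sum_(1 <= i < n.+1)
    \sum_(T <- small | (i * polya_size T == j)%N) (polya_size T)%:R *: coef T i) * Z (n - j)).
  under [RHS]eq_bigr do (rewrite big_distrl /=; under eq_bigr do rewrite big_distrl /=).
  rewrite exchange_big [RHS]exchange_big /= [LHS]big_nat [RHS]big_nat.
  apply: eq_bigr => i /andP[i1 _].
  rewrite [RHS](exchange_big_dep xpredT) //=; apply: eq_bigr => T _.
  under eq_bigl do rewrite eq_sym; rewrite big_nat1_eq ltnS muln_gt0 i1 polya_size_gt0 /=.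
  by case: ifP; rewrite ?mulr0.
rewrite [LHS]big_nat [RHS]big_nat; apply: eq_bigr => j /andP[j1 jn]; congr (_ * _).
have n1 : (1 < n.+1)%N by lia.
rewrite [LHS]big_ltn // [RHS]scalerDr; congr (_ + _).
  rewrite -(@sum_small_polya _ n) // scaler_sumr; apply: eq_big => T; first by rewrite mul1n.
  by rewrite mul1n => /eqP->.
rewrite -mul_polyC -polyCM /Tser_tail big_distrr /= rmorph_sum /=.
(* No tree satisfies [i * polya_size T = j] when [i > j]. *)
rewrite (big_cat_nat (n := j.+1)) //= [X in _ + X = _]big_nat [X in _ + X = _]big1
  ?addr0; last first.
  move=> i /andP[ji _]; apply: big_pred0 => T; apply/negbTE/eqP => iT.
  by have := polya_size_gt0 T; move: iT ji; case: (polya_size T) => // k; rewrite mulnS; lia.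
rewrite [LHS]big_nat [RHS]big_nat; apply: eq_bigr => i /andP[i2 ij].
(* If [j = d * i], each tree of size [d] contributes [d], which is [j / i]; if [i] does not divide
   [j], both sides are 0. *)
rewrite /fps_subst_pow; case: ifP => [/dvdnP[d jE]|idj].
  have i0 : (0 < i)%N by lia.
  have i0' : i%:R != 0 :> rat by rewrite (Num.Theory.pnatr_eq0 rat) -lt0n.
  have coef1 T : coef T i = 1 by rewrite /coef; case: eqP i2 => // ->.
  rewrite jE mulnK // natrM (_ : _ * _ = d%:R * Tser d); last by field.
  transitivity (\sum_(T \in polya_of_size d) ((d%:R : rat)%:P : {poly rat})).
    rewrite -(@sum_small_polya _ n); last first.
      by rewrite -ltnS; apply: leq_ltn_trans jn; rewrite jE leq_pmulr.
    apply: eq_big => T; first by rewrite mulnC eqn_pmul2r.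
    by rewrite mulnC eqn_pmul2r // => /eqP->; rewrite coef1 alg_polyC.
  rewrite fsbig_finite; last exact: finite_polya_of_size.
  by rewrite big_const_seq count_predT iter_addr_0 -[LHS]mulr_natr -polyC_natr -polyCM.
rewrite mul0r mulr0; apply: big_pred0 => T; apply/negbTE/eqP => jE.
by rewrite -jE dvdn_mulr in idj.
Qed.

End ForestRecurrence.

(** * Formal power series *)

Section Truncation.
Variable R : comUnitRingType.
Implicit Types (A B : nat -> R) (p q : {poly R}).

(** Truncation gives access to the product and the derivative of polynomials, without affecting the
    coefficients up to degree [N]. *)
Definition fps_trunc N A : {poly R} := \poly_(i < N.+1) A i.

Lemma coef_fps_trunc N A n : (n <= N)%N -> (fps_trunc N A)`_n = A n.
Proof. by rewrite coef_poly ltnS => ->. Qed.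

Lemma coefM_eq p p' q q' n :
  (forall m, (m <= n)%N -> p`_m = p'`_m) -> (forall m, (m <= n)%N -> q`_m = q'`_m) ->
  (p * q)`_n = (p' * q')`_n.
Proof.
move=> pp' qq'; rewrite !coefM; apply: eq_bigr => i _.
by rewrite pp' ?qq' ?leq_subr // -ltnS.
Qed.

Lemma coef_fps_mul N A B n : (n <= N)%N ->
  (fps_trunc N A * fps_trunc N B)`_n = fps_mul A B n.
Proof.
move=> nN; rewrite coefM; apply: eq_bigr => i _.
by rewrite !coef_fps_trunc //; have := ltn_ord i; lia.
Qed.

Lemma coef_fps_exp_nat N A k n : (n <= N)%N ->
  (fps_trunc N A ^+ k)`_n = fps_exp_nat A k n.
Proof.
elim: k n => [|k IHk] n nN; first by rewrite expr0 coef1.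
rewrite exprS coefM; apply: eq_bigr => i _.
by rewrite coef_fps_trunc ?IHk //; have := ltn_ord i; lia.
Qed.

Lemma coef_exp_small p k n : p`_0 = 0 -> (n < k)%N -> (p ^+ k)`_n = 0.
Proof.
move=> p0; elim: k n => // k IHk n nk.
rewrite exprS coefM big1 // => -[[|i] /= ik] _; first by rewrite p0 mul0r.
by rewrite IHk ?mulr0 //; lia.
Qed.

(** The ring will also be [{poly rat}], which is not a field. *)
Hypothesis fact_unit : forall k, k`!%:R \is a @GRing.unit R.

Definition poly_exp N p : {poly R} := \sum_(k < N.+1) k`!%:R^-1 *: p ^+ k.

Lemma coef_fps_exp N A n : A 0%N = 0 -> (n <= N)%N ->
  (poly_exp N (fps_trunc N A))`_n = fps_exp A n.
Proof.
move=> A0 nN; rewrite coef_sum /fps_exp.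
rewrite (big_ord_widen N.+1 (fun k => (k`!)%:R^-1 * fps_exp_nat A k n)) //.
rewrite [RHS]big_mkcond /=; apply: eq_bigr => k _; rewrite coefZ.
case: ltnP => [kn|nk]; first by rewrite coef_fps_exp_nat.
by rewrite coef_exp_small ?mulr0 ?coef_fps_trunc.
Qed.

Lemma deriv_poly_exp N p : (poly_exp N.+1 p)^`() = p^`() * poly_exp N p.
Proof.
rewrite /poly_exp big_ord_recl derivD expr0 derivZ derivC scaler0 add0r.
rewrite raddf_sum big_distrr; apply: eq_bigr => k _ /=.
rewrite derivZ /bump /= add1n deriv_exp /= -scalerAr -scaler_nat scalerA; congr (_ *: _).
have k1 : k.+1%:R \is a @GRing.unit R.
  by have := fact_unit k.+1; rewrite factS natrM unitrM => /andP[].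
by rewrite factS natrM invrM // -mulrA mulVr ?mulr1.
Qed.

(** The coefficient of degree [n] in [(exp A)' = A' exp A]. *)
Lemma fps_exp_rec A n : A 0%N = 0 ->
  n.+1%:R * fps_exp A n.+1 = \sum_(i < n.+1) (i.+1%:R * A i.+1) * fps_exp A (n - i).
Proof.
move=> A0; rewrite -(@coef_fps_exp n.+1) // mulr_natl -coef_deriv deriv_poly_exp coefM.
apply: eq_bigr => i _; have iN := ltn_ord i.
rewrite coef_deriv coef_fps_trunc // mulr_natl; congr (_ * _).
rewrite -(@coef_fps_exp n.+1) //; last lia.
(* The derivative has lost the power [n.+1]; that power has no coefficient in degree [n - i], since
   the constant term is 0. *)
rewrite /poly_exp [in RHS]big_ord_recr /= coefD coefZ coef_exp_small ?mulr0 ?addr0 //.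
  by rewrite coef_fps_trunc.
lia.
Qed.

(** The Leibniz rule: [A' = a A] and [B' = b B] give [(A B)' = (a + b) A B]. *)
Lemma fps_mul_rec (A B a b : nat -> R) n :
  (forall m, (m <= n)%N -> m.+1%:R * A m.+1 = \sum_(i < m.+1) a i * A (m - i)%N) ->
  (forall m, (m <= n)%N -> m.+1%:R * B m.+1 = \sum_(i < m.+1) b i * B (m - i)%N) ->
  n.+1%:R * fps_mul A B n.+1 = \sum_(i < n.+1) (a i + b i) * fps_mul A B (n - i).
Proof.
move=> Aa Bb; set t := fps_trunc n.+1.
have dE (C c : nat -> R) m : (m <= n)%N ->
    m.+1%:R * C m.+1 = \sum_(i < m.+1) c i * C (m - i)%N ->
    (t C)^`()`_m = (t c * t C)`_m.
  move=> mn Cc; rewrite coef_deriv coef_fps_trunc // -[LHS]mulr_natl Cc coefM.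
  by apply: eq_bigr => i _; rewrite !coef_fps_trunc //; have := ltn_ord i; lia.
rewrite -(@coef_fps_mul n.+1) // mulr_natl -coef_deriv derivM coefD.
transitivity (((t a + t b) * (t A * t B))`_n).
  rewrite mulrDl coefD; congr (_ + _).
    by rewrite mulrA; apply: coefM_eq => // m mn; apply: dE => //; apply: Aa.
  by rewrite mulrCA; apply: coefM_eq => // m mn; apply: dE => //; apply: Bb.
rewrite coefM; apply: eq_bigr => i _; have iN := ltn_ord i.
by rewrite coefD !coef_fps_trunc ?coef_fps_mul //; lia.
Qed.

End Truncation.

Lemma fps_exp0 (R : comUnitRingType) (A : nat -> R) : fps_exp A 0 = 1.
Proof. by rewrite /fps_exp big_ord_recl big_ord0 addr0 /= invr1 mul1r. Qed.

(** * The series of trees and forests, and their values at [u = 0] *)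

Definition polya_series n : {poly rat} := \sum_(T \in polya_of_size n) tpoly T.

Lemma polya_series0 : polya_series 0 = 0.
Proof.
apply: fsbig1 => T; rewrite /polya_of_size /= => T0.
by have := polya_size_gt0 T; rewrite T0.
Qed.

Definition forest_series n : {poly rat} :=
  \sum_(F \in forests_of_size n) aut_average (forest_graph F).

Lemma forest_series0 : forest_series 0 = 1.
Proof.
rewrite /forest_series (_ : forests_of_size 0 = [set mset0]%classic).
  rewrite fsbig_set1 (@aut_average_forest _ [::]) ?big_nil //.
  by move=> T; rewrite in_mset0.
apply/seteqP; split=> F; rewrite /forests_of_size /=; last first.
  by move=> ->; rewrite forest_sizeE enum_mset0 big_nil.
move=> F0.
rewrite -[F]seq_mset_id (_ : enum_mset F = [::]).
  by apply/msetP => T; rewrite mset_seqE mset0E.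
apply/eqP; rewrite -size_eq0 -leqn0 -F0 forest_sizeE.
exact/leq_size_sum/polya_size_gt0.
Qed.

Lemma Dser_rec n :
  n.+1%:R * Dser n.+1 = \sum_(i < n.+1) (i.+1%:R * Tser_tail i.+1) * Dser (n - i).
Proof.
apply: fps_exp_rec; last by rewrite /Tser_tail big_geq.
by move=> k; rewrite unitfE fact_neq0.
Qed.

(** Both sides start with 1 and satisfy the same recurrence, in which division by [n.+1] determines
    each coefficient from the previous ones. *)
Lemma forest_seriesE n :
  forest_series n = fps_mul (fps_exp polya_series) (fun n => (Dser n)%:P) n.
Proof.
set C := fps_mul _ _.
have fact_unit k : k`!%:R \is a @GRing.unit {poly rat}.
  by rewrite -polyC_natr rmorph_unit // unitfE fact_neq0.
have CS m : m.+1%:R * C m.+1 =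
    \sum_(i < m.+1)
      (i.+1%:R * polya_series i.+1 + (i.+1%:R * Tser_tail i.+1)%:P) * C (m - i)%N.
  apply: (@fps_mul_rec _ _ _ (fun i => i.+1%:R * polya_series i.+1)
    (fun i => (i.+1%:R * Tser_tail i.+1)%:P)) => k _; first exact: fps_exp_rec polya_series0.
  rewrite -[k.+1%:R]polyC_natr -polyCM Dser_rec rmorph_sum.
  by apply: eq_bigr => i _; rewrite -polyCM.
elim/ltn_ind: n => -[|n] IHn.
  rewrite forest_series0 /C /fps_mul big_ord_recl big_ord0 addr0.
  by rewrite fps_exp0 /Dser fps_exp0 mul1r.
have n0 : n.+1%:R != 0 :> rat by rewrite (Num.Theory.pnatr_eq0 rat).
apply: (scalerI n0); rewrite [LHS]forests_recurrence -mul_polyC polyC_natr CS.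
rewrite big_add1 /= big_mkord; apply: eq_bigr => i _.
rewrite subSS -/(forest_series _) -/(polya_series _) IHn; last by have := ltn_ord i; lia.
by congr (_ * _); rewrite scalerDr -!mul_polyC polyC_natr polyCM polyC_natr.
Qed.

Lemma polya_series_equation : Tc_equation polya_series.
Proof.
case=> [|n].
  by rewrite polya_series0 /Tc_rhs [in RHS]/fps_mul big_ord_recl big_ord0 mul0r addr0.
rewrite [LHS]sum_polya_plant -/(forest_series n) forest_seriesE.
(* Multiplication by [z u] keeps only the term of index 1. *)
rewrite /Tc_rhs; set C := fps_mul (fps_exp _) _; rewrite /fps_mul 2!big_ord_recl /=.
by rewrite mul0r add0r subn1 big1 ?addr0 // => i _; rewrite mul0r.
Qed.

Lemma aut_average_horner0 F : (aut_average (forest_graph F)).[0] = forest_weight F.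
Proof. by rewrite hornerZ autpoly0 mulrC. Qed.

Lemma tpoly_horner0 T : (tpoly T).[0] = 0.
Proof. by have [F <-] := plant_surj T; rewrite tpoly_plant hornerM hornerX mul0r. Qed.

(** A tree [T] of multiplicity one contributes the factor [exp_trunc (tpoly T - 1) 1 = tpoly T],
    which vanishes at 0 because every automorphism of [T] fixes its root. *)
Lemma forest_weight_eq0 F : ~ mset_ge2 F -> forest_weight F = 0.
Proof.
move=> /existsNP[T] /not_implyP[TF /negP]; rewrite -leqNgt => FT.
have {FT} FT1 : F T = 1%N by apply/eqP; rewrite eqn_leq FT -in_mset.
rewrite -aut_average_horner0 (@aut_average_forest _ (undup F)) ?undup_uniq //; last first.
  by move=> U; rewrite mem_undup.
rewrite (bigD1_seq T) ?undup_uniq ?mem_undup //= FT1 hornerM.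
rewrite /exp_trunc /= invr1 scale1r expr1 mulr1 addrC subrK.
by rewrite tpoly_horner0 mul0r.
Qed.

Lemma fps_exp_polya_horner0 n : (fps_exp polya_series n).[0] = (n == 0%N)%:R.
Proof.
have S0 m : (polya_series m).[0] = 0.
  rewrite /polya_series fsbig_finite ?horner_sum; last exact: finite_polya_of_size.
  by rewrite big1 // => T _; apply: tpoly_horner0.
rewrite horner_sum big_ord_recl big1 ?addr0 => [|k _].
  by rewrite hornerM /= invr1 hornerC mul1r /fps_one; case: (n == 0%N); rewrite hornerC.
rewrite hornerM /= [X in _ * X](_ : _ = 0) ?mulr0 //.
by rewrite horner_sum big1 // => i _; rewrite hornerM S0 mul0r.
Qed.

Lemma forest_series_horner0 n : (forest_series n).[0] = Dser n.
Proof.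
rewrite forest_seriesE horner_sum big_ord_recl big1 ?addr0 => [|i _].
  by rewrite hornerM fps_exp_polya_horner0 hornerC mul1r subn0.
by rewrite hornerM fps_exp_polya_horner0 mul0r.
Qed.

(** At [u = 0] the forest series is [Dser], and the forests outside [mset_ge2] add 0 to the sum. *)
Lemma Dser_forest_weight n :
  Dser n = \sum_(F \in forests_ge2_of_size n) forest_weight F.
Proof.
rewrite -forest_series_horner0 /forest_series.
rewrite fsbig_finite; last exact: finite_forests_of_size.
rewrite horner_sum -fsbig_finite; last exact: finite_forests_of_size.
under eq_fsbigr do rewrite aut_average_horner0.
apply/esym/fsbig_widen => F /=; first by case.
by case=> Fn /not_andP[|//] /forest_weight_eq0.
Qed.

Theorem theorem2 :
  (forall n : nat,
     Dser n = \sum_(F \in forests_ge2_of_size n) forest_weight F)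
  /\ (forall Tc : nat -> {poly rat}, Tc_equation Tc ->
      forall n : nat, (1 <= n)%N ->
        Tc n = \sum_(T \in polya_of_size n) tpoly T)
  /\ (forall T : polya, (tpoly T)^`().[1] = #|pointings T|%:R).
Proof.
split; first exact: Dser_forest_weight.
split; last exact: tpoly_deriv1.
by move=> Tc TcE n _; rewrite (Tc_unique TcE polya_series_equation).
Qed.
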